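(* Let $\mathcal{F}$ be an embedded transnormal system of codimension one on a complete Riemannian manifold $M$, let $\hat\pi:\hat M\to M$ be a regular Riemannian covering map, and let $\hat{\mathcal{F}}$ be the lift of $\mathcal{F}$ to $\hat M$. Then $\hat\pi:(\hat M,\hat{\mathcal{F}})\to(M,\mathcal{F})$ can be uniquely decomposed into a regular covering sequence $$(\hat M,\hat{\mathcal{F}})\xrightarrow{\ p\ }(\tilde M,\tilde{\mathcal{F}})\xrightarrow{\ \tilde\pi\ }(M,\mathcal{F}),\qquad \hat\pi=\tilde\pi\circ p,$$ satisfying the following conditions: (C1) for every $g\in G(\hat M,p)$ and every $\hat F\in\hat{\mathcal{F}}$, $g(\hat F)=\hat F$; (C2) if $\phi\in G(\tilde M,\tilde\pi)$ satisfies $\phi(\tilde F)=\tilde F$ for every $\tilde F\in\tilde{\mathcal{F}}$, then $\phi$ is the identity.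
   Context: Manifolds are smooth and connected. A transnormal system on a complete Riemannian manifold is a partition into connected submanifolds (foils) such that every geodesic intersects the foils orthogonally at all or none of its points; it is embedded if all foils are embedded, and its codimension is the codimension of a foil of greatest dimension. The lift of $\mathcal{F}$ along a Riemannian covering $\hat\pi$ is the transnormal system whose foils are the connected components of the preimages $\hat\pi^{-1}(F)$, $F\in\mathcal{F}$. In a regular covering sequence both $p$ and $\tilde\pi$ are regular (normal) Riemannian coverings and $\tilde{\mathcal{F}}$ is the lift of $\mathcal{F}$ along $\tilde\pi$. $G(X,q)$ denotes the covering transformation group of a covering $q$ with total space $X$. Uniqueness is understood up to isomorphism of the intermediate covering. *)

(* Defs.v *)
From HB Require Import structures.
From mathcomp Require Import all_boot all_order all_algebra.
From mathcomp Require Import all_classical all_reals all_analysis.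

Set Implicit Arguments.
Unset Strict Implicit.
Unset Printing Implicit Defensive.

Import Order.TTheory GRing.Theory Num.Theory.
Import numFieldNormedType.Exports.

Local Open Scope classical_set_scope.
Local Open Scope ring_scope.

(* Riemannian manifolds are set up in local coordinates: a topological space, an
   atlas with values in 'rV[R]_n, and the matrices (g_ij) of the metric in the
   charts of the atlas. *)

Section Smoothness.
Context {R : realType} {V W : normedModType R}.

(* Meant for open U, where differentiability at a point of U only involves
   values of f on U.  Requiring all iterated directional derivatives to be
   differentiable is, in finite dimension, the usual C^infinity condition. *)
Fixpoint differentiable_upto (k : nat) (U : set V) (f : V -> W) : Prop :=
  match k with
  | 0 => forall x, U x -> {for x, continuous f}
  | k'.+1 => (forall x, U x -> differentiable f x) /\
             forall v, differentiable_upto k' U (fun x => 'D_v f x)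
  end.

Definition smooth_on (U : set V) (f : V -> W) : Prop :=
  forall k, differentiable_upto k U f.

End Smoothness.

(* The functions are total; only their values on chart_dom, resp. chart_img,
   are relevant. *)
Record chart (R : realType) (X : topologicalType) (n : nat) := Chart {
  chart_dom : set X;
  chart_img : set 'rV[R]_n;
  chart_fun : X -> 'rV[R]_n;
  chart_inv : 'rV[R]_n -> X;
  chart_dom_open : open chart_dom;
  chart_img_open : open chart_img;
  chart_fun_img : forall x, chart_dom x -> chart_img (chart_fun x);
  chart_inv_dom : forall y, chart_img y -> chart_dom (chart_inv y);
  chart_funK : forall x, chart_dom x -> chart_inv (chart_fun x) = x;
  chart_invK : forall y, chart_img y -> chart_fun (chart_inv y) = y;
  chart_fun_continuous : forall x, chart_dom x -> {for x, continuous chart_fun};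
  chart_inv_continuous : forall y, chart_img y -> {for y, continuous chart_inv}
}.

Section LocalExpressions.
Context {R : realType} {X Y : topologicalType} {n m : nat}.
Implicit Types (c : chart R X n) (d : chart R Y m).

Definition in_charts c d (f : X -> Y) : 'rV[R]_n -> 'rV[R]_m :=
  chart_fun d \o f \o chart_inv c.

Definition in_charts_dom c d (U : set X) (f : X -> Y) : set 'rV[R]_n :=
  [set y | [/\ chart_img c y, U (chart_inv c y)
             & chart_dom d (f (chart_inv c y))]].

(* g and h are the matrices of the metrics in c and d; with the row-vector
   convention, [jacobian F y] maps v to the differential of F at y by
   v |-> v *m jacobian F y. *)
Definition pullback_metric c d (g : 'rV[R]_n -> 'M[R]_n)
    (h : 'rV[R]_m -> 'M[R]_m) (U : set X) (f : X -> Y) : Prop :=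
  forall y, in_charts_dom c d U f y ->
    let J := jacobian (in_charts c d f) y in
    g y = J *m h (in_charts c d f y) *m J^T.

End LocalExpressions.

Definition smooth_transition {R : realType} {X : topologicalType} {n : nat}
    (c d : chart R X n) : Prop :=
  smooth_on (in_charts_dom c d setT idfun) (in_charts c d idfun).

Record riemannian_manifold (R : realType) (n : nat) := RiemannianManifold {
  carrier :> topologicalType;
  manifold_nonempty : [set: carrier] !=set0;
  manifold_connected : connected [set: carrier];
  manifold_hausdorff : hausdorff_space carrier;
  manifold_second_countable : @second_countable carrier;
  atlas_index : Type;
  atlas : atlas_index -> chart R carrier n;
  atlas_cover : forall x, exists i, chart_dom (atlas i) x;
  atlas_smooth : forall i j, smooth_transition (atlas i) (atlas j);
  metric : atlas_index -> 'rV[R]_n -> 'M[R]_n;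
  metric_smooth : forall i, smooth_on (chart_img (atlas i)) (metric i);
  metric_sym : forall i y, chart_img (atlas i) y -> (metric i y)^T = metric i y;
  metric_pos : forall i y, chart_img (atlas i) y ->
    forall v : 'rV[R]_n, v != 0 -> 0 < (v *m metric i y *m v^T) 0 0;
  metric_compatible : forall i j,
    pullback_metric (atlas i) (atlas j) (metric i) (metric j) setT idfun
}.

Section Manifold.
Context {R : realType} {n : nat} (M : riemannian_manifold R n).

(* Charts of the maximal atlas. *)
Definition compatible_chart (c : chart R M n) : Prop :=
  forall i, smooth_transition c (atlas i) /\ smooth_transition (atlas i) c.

Definition in_chart (i : atlas_index M) (gamma : R -> M) : R -> 'rV[R]_n :=
  chart_fun (atlas i) \o gamma.

Definition smooth_curve (J : set R) (gamma : R -> M) : Prop :=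
  (forall t, J t -> {for t, continuous gamma}) /\
  forall i, smooth_on (J `&` gamma @^-1` chart_dom (atlas i))
                      (in_chart i gamma).

Definition christoffel (i : atlas_index M) (x : 'rV[R]_n) (k a b : 'I_n) : R :=
  let g := metric i in
  let pd c d e := 'D_(delta_mx 0 c : 'rV[R]_n) (fun y => g y d e) x in
  2^-1 * \sum_l invmx (g x) k l * (pd a b l + pd b a l - pd l a b).

Definition geodesic (J : set R) (gamma : R -> M) : Prop :=
  [/\ open J, is_interval J, smooth_curve J gamma &
   forall t i, J t -> chart_dom (atlas i) (gamma t) ->
     let x := in_chart i gamma in
     forall k, (derive1 (derive1 x) t) 0 k +
       \sum_a \sum_b christoffel i (x t) k a b *
         (derive1 x t) 0 a * (derive1 x t) 0 b = 0].

Definition complete_manifold : Prop :=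
  forall J gamma, geodesic J gamma ->
    exists gamma', geodesic setT gamma' /\ forall t, J t -> gamma' t = gamma t.

Definition embedded_submanifold (k : nat) (S : set M) : Prop :=
  (k <= n)%N /\
  forall x, S x -> exists c : chart R M n,
    [/\ compatible_chart c, chart_dom c x &
        forall z, chart_dom c z ->
          S z <-> forall a : 'I_n, (k <= a)%N -> chart_fun c z 0 a = 0].

(* v is the coordinate vector, in the chart i, of a vector tangent to S at x. *)
Definition tangent_vector (S : set M) (x : M) (i : atlas_index M)
    (v : 'rV[R]_n) : Prop :=
  exists (e : R) (sigma : R -> M),
    [/\ 0 < e, smooth_curve `]- e, e[ sigma, sigma 0 = x,
        `]- e, e[ `<=` sigma @^-1` S & v = derive1 (in_chart i sigma) 0].

Definition orthogonal_at (S : set M) (gamma : R -> M) (t : R) : Prop :=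
  forall i, chart_dom (atlas i) (gamma t) ->
  forall v, tangent_vector S (gamma t) i v ->
    (derive1 (in_chart i gamma) t *m metric i (in_chart i gamma t) *m v^T) 0 0 = 0.

Definition is_partition (F : set (set M)) : Prop :=
  [/\ forall A, F A -> A !=set0,
      forall x, exists2 A, F A & A x &
      forall A B, F A -> F B -> A `&` B !=set0 -> A = B].

Definition embedded_transnormal_system (F : set (set M)) : Prop :=
  [/\ is_partition F,
      forall A, F A -> connected A /\ exists k, embedded_submanifold k A &
      forall J gamma, geodesic J gamma ->
        (forall t A, J t -> F A -> A (gamma t) -> orthogonal_at A gamma t) \/
        (forall t A, J t -> F A -> A (gamma t) -> ~ orthogonal_at A gamma t)].

Definition has_codimension (F : set (set M)) (q : nat) : Prop :=
  exists k, [/\ (k + q)%N = n,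
    exists2 A, F A & embedded_submanifold k A &
    forall A l, F A -> embedded_submanifold l A -> (l <= k)%N].

End Manifold.

Section Coverings.
Context {R : realType} {n : nat}.
Implicit Types X Y : riemannian_manifold R n.

Definition smooth_map_on X Y (U : set X) (f : X -> Y) : Prop :=
  (forall x, U x -> {for x, continuous f}) /\
  forall i j, smooth_on (in_charts_dom (atlas i) (atlas j) U f)
                        (in_charts (atlas i) (atlas j) f).

Definition preserves_metric_on X Y (U : set X) (f : X -> Y) : Prop :=
  forall i j,
    pullback_metric (atlas i) (atlas j) (metric i) (metric j) U f.

Definition local_isometry X Y (f : X -> Y) : Prop :=
  forall x, exists U : set X,
    [/\ open U, U x, open (f @` U),
        smooth_map_on U f /\ preserves_metric_on U f &
        exists s : Y -> X, smooth_map_on (f @` U) s /\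
          forall z, U z -> s (f z) = z].

Definition riemannian_isometry X Y (f : X -> Y) : Prop :=
  [/\ smooth_map_on setT f, preserves_metric_on setT f &
      exists g : Y -> X, [/\ smooth_map_on setT g, cancel f g & cancel g f]].

Definition covering_map (X Y : topologicalType) (q : X -> Y) : Prop :=
  [/\ continuous q, forall y, exists x, q x = y &
   forall y, exists U : set Y, [/\ open U, U y &
     exists S : set (set X),
       [/\ q @^-1` U = \bigcup_(V in S) V,
           forall V V', S V -> S V' -> V `&` V' !=set0 -> V = V' &
           forall V, S V -> open V /\
             exists s : Y -> X,
               [/\ forall z, U z -> {for z, continuous s},
                   forall z, U z -> V (s z),
                   forall z, U z -> q (s z) = z &
                   forall x, V x -> s (q x) = x]]]].

Definition covering_transformation (X Y : topologicalType) (q : X -> Y) :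
    set (X -> X) :=
  [set g | [/\ continuous g, q \o g = q &
     exists h : X -> X, [/\ continuous h, cancel g h & cancel h g]]].

Definition regular_covering (X Y : topologicalType) (q : X -> Y) : Prop :=
  covering_map q /\
  forall x x', q x = q x' ->
    exists2 g, covering_transformation q g & g x = x'.

(* For embedded foils the submanifold topology is the subspace topology used by
   connected_component. *)
Definition lifted_system (X Y : topologicalType) (q : X -> Y) (F : set (set Y)) :
    set (set X) :=
  [set C | exists A x, [/\ F A, A (q x) & C = connected_component (q @^-1` A) x]].

(* The arrows (X, FX) -> (Y, FY) of a regular covering sequence. *)
Definition regular_system_covering X Y (FX : set (set X)) (FY : set (set Y))
    (q : X -> Y) : Prop :=
  [/\ regular_covering q, local_isometry q & FX = lifted_system q FY].

Definition regular_decomposition (Mhat Mtil M : riemannian_manifold R n)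
    (Fhat : set (set Mhat)) (Ftil : set (set Mtil)) (F : set (set M))
    (pihat : Mhat -> M) (p : Mhat -> Mtil) (pitil : Mtil -> M) : Prop :=
  [/\ regular_system_covering Fhat Ftil p, regular_system_covering Ftil F pitil
    & pihat = pitil \o p].

Definition condC1 X Y (FX : set (set X)) (p : X -> Y) : Prop :=
  forall g, covering_transformation p g -> forall A, FX A -> g @` A = A.

Definition condC2 X Y (FX : set (set X)) (q : X -> Y) : Prop :=
  forall phi, covering_transformation q phi ->
    (forall A, FX A -> phi @` A = A) -> phi = idfun.

End Coverings.

(* Main.v *)
(* Let N be the group of deck transformations of [pihat] that map every leaf of
   the lifted system to itself.  It is normal, because deck transformations
   permute the leaves, so Mtil := Mhat / N covers M regularly.  The quotient map
   sends leaves onto leaves: embedded foils are locally connected, hence leaves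
   are open in the preimage of their foil, and the image of a leaf is open and
   closed in the leaf that contains it.  Since N preserves leaves, the preimage
   of a leaf of Mtil is a single leaf of Mhat; hence a leaf-preserving deck
   transformation of Mtil lifts to an element of N and is the identity.
   Conversely, in any other decomposition (C1) puts the deck group of p' inside
   N, while (C2) makes the transformation of Mtil' induced by an element of N
   trivial; so p and p' have the same fibres. *)

Require Import Defs.
From HB Require Import structures.
From mathcomp Require Import all_boot all_order all_algebra.
From mathcomp Require Import all_classical all_reals all_analysis.
From mathcomp Require Import lra.

Set Implicit Arguments.
Unset Strict Implicit.
Unset Printing Implicit Defensive.

Import Order.TTheory GRing.Theory Num.Theory.
Import numFieldNormedType.Exports.

Local Open Scope classical_set_scope.
Local Open Scope ring_scope.

(** * Smoothness is local *)

(** The quotient is first built as a bare topological space [X]. Its Riemannian structure is then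
    pulled back from [M] along [pi : X -> M] rather than pushed down from [Mhat]: a chart of the
    quotient is a chart of [M] composed with [pi] on a sheet, with the same metric matrix.
    Smoothness, geodesics, orthogonality and slice charts thus reduce to the same notions in [M].
    Covering theory supplies the rest: uniqueness of lifts makes deck transformations rigid, and
    path lifting gives completeness. Uniqueness of the decomposition likewise starts from a
    homeomorphism over [M], which is an isometry because it is locally a section of a local isometry
    composed with a projection. *)

Section SmoothnessIsLocal.
Context {R : realType} {V W : normedModType R}.

Lemma near_eq_differentiable (f g : V -> W) (x : V) :
  (\near x, f x = g x) -> differentiable f x -> differentiable g x.
Proof.
move=> fg df.
have fgx : f x = g x by exact: nbhs_singleton fg.
have e : g \o shift x = cst (g x) + 'd f x +o_ 0 id.
  have /diff_locally dfx := df.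
  apply/eqaddoP => eps e0.
  move/eqaddoP: dfx => /(_ eps e0).
  have fg0 : \forall h \near (0 : V), f (h + x) = g (h + x).
    move: fg; rewrite (near_shift 0 x) /=; apply: filterS => h.
    by rewrite subr0.
  apply: filter_app; near=> h.
  have -> // : (f \o shift x - (cst (f x) + 'd f x)) h =
               (g \o shift x - (cst (g x) + 'd f x)) h.
  rewrite !fctE /= fgx; congr (_ - _).
  by near: h; exact: fg0.
have dgf := diff_unique (diff_continuous df) e.
by apply/diff_locallyP; rewrite dgf; split => //; exact: diff_continuous.
Unshelve. all: by end_near. Qed.

(** Derivatives are those of the total function [f]; the set only says where conditions are imposed.
    Locality can therefore be proved one point at a time. *)
Lemma differentiable_upto_pointwise k (U : set V) (f : V -> W) :
  differentiable_upto k U f <->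
  (forall x, U x -> differentiable_upto k [set x] f).
Proof.
elim: k f => [|k IH] f /=.
  by split=> [h x Ux _ ->|h x Ux]; [exact: h|exact: (h x)].
split=> [[d h] x Ux|h].
  split=> [_ ->|v]; first exact: d.
  by move: (h v) => /IH; exact.
split=> [x Ux|v]; first by apply: (h x Ux).1.
by apply/IH => x Ux; exact: (h x Ux).2.
Qed.

Lemma near_eq_differentiable_upto k (x : V) (f g : V -> W) :
  (\near x, f x = g x) ->
  differentiable_upto k [set x] f -> differentiable_upto k [set x] g.
Proof.
elim: k f g => [|k IH] f g fg /=.
  move=> cf _ ->; have := cf x erefl.
  rewrite /prop_for /continuous_at -(nbhs_singleton fg) => cfx.
  by apply: cvg_trans cfx; apply: near_eq_cvg.
move=> [df h]; split=> [_ ->|v].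
  exact: near_eq_differentiable fg (df x erefl).
apply: IH (h v).
(* The induction needs the derivatives to agree near [x], not just at [x]: equality near [x] is
   equality near every nearby [y]. *)
have := near_join fg; apply: filter_app; near=> y.
by move=> fgy; exact: near_eq_derive.
Unshelve. all: by end_near. Qed.

Lemma smooth_on_sub (U U' : set V) (f : V -> W) :
  U' `<=` U -> smooth_on U f -> smooth_on U' f.
Proof.
move=> UU' sf k; apply/differentiable_upto_pointwise => x /UU' Ux.
by move/differentiable_upto_pointwise: (sf k); exact.
Qed.

Lemma smooth_on_local (U : set V) (f : V -> W) :
  (forall x, U x -> exists (g : V -> W) (U' : set V),
     [/\ smooth_on U' g, U' x & \near x, g x = f x]) ->
  smooth_on U f.
Proof.
move=> h k; apply/differentiable_upto_pointwise => x /h [g [U' [sg U'x gf]]].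
apply: near_eq_differentiable_upto gf _.
by move/differentiable_upto_pointwise: (sg k); exact.
Qed.

Lemma smooth_on_differentiable (U : set V) (f : V -> W) (x : V) :
  smooth_on U f -> U x -> differentiable f x.
Proof. by move=> sf Ux; exact: (sf 1%N).1. Qed.

End SmoothnessIsLocal.

(** * Covering maps *)

Section Topology.

Lemma open_local (X : topologicalType) (A : set X) :
  (forall x, A x -> exists Q, [/\ open Q, Q x & Q `<=` A]) -> open A.
Proof.
move=> h; rewrite openE => x /h [Q [oO Ox OA]].
by rewrite /interior nbhsE; exists Q.
Qed.

Lemma open_nbhsW (X : topologicalType) (Q : set X) x : open Q -> Q x -> nbhs x Q.
Proof. by move=> oO Ox; apply: open_nbhs_nbhs. Qed.

Lemma open_setI_preimage (X Y : topologicalType) (f : X -> Y) (U : set X)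
    (V : set Y) :
  open U -> (forall x, U x -> {for x, continuous f}) -> open V ->
  open (U `&` f @^-1` V).
Proof.
move=> oU cf oV; apply: open_local => x [Ux Vfx].
have nV : nbhs x (f @^-1` V) by apply: (cf x Ux); exact: open_nbhsW.
move: nV; rewrite nbhsE => -[Q [oO Ox] OV].
exists (U `&` Q); split => //; first exact: openI.
by move=> z [Uz Oz]; split => //; exact: OV.
Qed.

Lemma connected_image (X Y : topologicalType) (f : X -> Y) (A : set X) :
  (forall x, A x -> {for x, continuous f}) -> connected A -> connected (f @` A).
Proof.
move=> cf cA; apply: connected_continuous_connected => //.
by apply: continuous_in_subspaceT => x /[!inE] /cf.
Qed.

Lemma near_eq_continuous (X Y : topologicalType) (f g : X -> Y) (x : X) :
  (\near x, f x = g x) -> {for x, continuous f} -> {for x, continuous g}.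
Proof.
move=> fg; rewrite /prop_for /continuous_at -(nbhs_singleton fg) => cfx.
by apply: cvg_trans cfx; apply: near_eq_cvg.
Qed.

End Topology.

(* The section is total and a right inverse of [q] everywhere, although it is
   continuous only over [sheet_base]: local expressions read through [q] then
   agree as functions, not just locally. *)
Record sheet (X Y : topologicalType) (q : X -> Y) := Sheet {
  sheet_set : set X;
  sheet_base : set Y;
  sheet_sec : Y -> X;
  sheet_set_open : open sheet_set;
  sheet_base_open : open sheet_base;
  sheet_sec_continuous : forall y, sheet_base y -> {for y, continuous sheet_sec};
  sheet_base_image : forall x, sheet_set x -> sheet_base (q x);
  sheet_set_sec : forall y, sheet_base y -> sheet_set (sheet_sec y);
  sheet_secK : forall y, q (sheet_sec y) = y;
  sheet_projK : forall x, sheet_set x -> sheet_sec (q x) = x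
}.

Section Sheets.
Context {X Y : topologicalType} {q : X -> Y}.

Program Definition sheet_restrict (s : sheet q) (W : set X) (oW : open W) :
    sheet q :=
  @Sheet X Y q (sheet_set s `&` W)
    (sheet_base s `&` sheet_sec s @^-1` W) (sheet_sec s) _ _ _ _ _ _ _.
Next Obligation. by move=> s W oW; apply: openI => //; exact: sheet_set_open. Qed.
Next Obligation.
move=> s W oW; apply: open_setI_preimage => //; first exact: sheet_base_open.
exact: sheet_sec_continuous.
Qed.
Next Obligation. by move=> s W oW y [by1 _]; exact: sheet_sec_continuous. Qed.
Next Obligation.
move=> s W oW x [sx Wx]; split; first exact: sheet_base_image.
by rewrite /preimage /= sheet_projK.
Qed.
Next Obligation. by move=> s W oW y [? ?]; split=> //; exact: sheet_set_sec. Qed.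
Next Obligation. by move=> *; exact: sheet_secK. Qed.
Next Obligation. by move=> s W oW x [? _]; exact: sheet_projK. Qed.

End Sheets.

Section CoveringMaps.
Context {X Y : topologicalType} {q : X -> Y}.
Hypothesis cq : covering_map q.

Lemma covering_continuous : continuous q. Proof. by case: cq. Qed.

Lemma covering_surjective y : exists x, q x = y. Proof. by case: cq. Qed.

Lemma covering_right_inverse : exists r : Y -> X, cancel r q.
Proof. by have [r] := choice covering_surjective; exists r. Qed.

Lemma covering_sheet x : exists s : sheet q, sheet_set s x.
Proof.
have [r rK] := covering_right_inverse.
have [_ _ /(_ (q x)) [U [oU Uqx [S [qU _ Ssec]]]]] := cq.
have : (q @^-1` U) x by [].
rewrite qU => -[V SV Vx]; have [oV [s [cs sV qs sK]]] := Ssec V SV.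
have VU z : V z -> U (q z) by move=> Vz; suff: (q @^-1` U) z by []; rewrite qU; exists V.
(* The value [r y] off [U] makes [s'] a right inverse everywhere; continuity is only claimed on the
   open set [U], where [s'] agrees with [s]. *)
pose s' y := if pselect (U y) then s y else r y.
have s'E y : U y -> s' y = s y by rewrite /s'; case: pselect.
unshelve eexists (@Sheet _ _ q V U s' oV oU _ _ _ _ _) => //.
- move=> y Uy; apply: near_eq_continuous (cs y Uy).
  by apply: filterS (open_nbhsW oU Uy) => z /s'E.
- by move=> y Uy; rewrite s'E //; exact: sV.
- by move=> y; rewrite /s'; case: pselect => [Uy|nUy] /=; [exact: qs|exact: rK].
- by move=> z Vz; rewrite s'E; [exact: sK|exact: VU].
Qed.

Lemma covering_open_map (U : set X) : open U -> open (q @` U).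
Proof.
move=> oU; apply: open_local => _ [x Ux <-].
have [s sx] := covering_sheet x.
exists (sheet_base s `&` sheet_sec s @^-1` U); split.
- apply: open_setI_preimage => //; first exact: sheet_base_open.
  exact: sheet_sec_continuous.
- by split; [exact: sheet_base_image|rewrite /preimage /= sheet_projK].
- by move=> y [_ Usy]; exists (sheet_sec s y) => //; exact: sheet_secK.
Qed.

Lemma covering_continuous_descent (Z : topologicalType) (f : Y -> Z) x :
  {for x, continuous (f \o q)} -> {for q x, continuous f}.
Proof.
move=> cf; have [s sx] := covering_sheet x.
have fE : f = (f \o q) \o sheet_sec s.
  by apply/funext => y /=; rewrite sheet_secK.
rewrite fE; apply: continuous_comp.
  by apply: sheet_sec_continuous; exact: sheet_base_image.
by rewrite sheet_projK.
Qed.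

(** Two points of one fibre in the same sheet would coincide, because the section of the sheet
    recovers a point from its image. *)
Lemma covering_separates x x' : q x = q x' -> x <> x' ->
  exists V V', [/\ open V, open V', V x, V' x' & V `&` V' = set0].
Proof.
move=> qxx xx.
have [_ _ /(_ (q x)) [U [oU Uqx [S [qU Sdisj Ssec]]]]] := cq.
have : (q @^-1` U) x by [].
rewrite qU => -[V SV Vx].
have : (q @^-1` U) x' by rewrite /preimage /= -qxx.
rewrite qU => -[V' SV' V'x'].
exists V, V'; split => //; [exact: (Ssec V SV).1|exact: (Ssec V' SV').1|].
apply: contrapT => /eqP/set0P /(Sdisj _ _ SV SV') VV'.
move: V'x'; rewrite -VV' => Vx'.
have [_ [s [_ _ _ sK]]] := Ssec V SV.
by apply: xx; rewrite -(sK x Vx) qxx sK.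
Qed.

Lemma covering_hausdorff : hausdorff_space Y -> hausdorff_space X.
Proof.
rewrite !open_hausdorff => hY x x' /eqP xx.
have [qxx|/hY [[A B] [/= /[!inE] Ax Bx'] [oA oB AB]]] := eqVneq (q x) (q x').
  have [V [V' [oV oV' Vx V'x' VV']]] := covering_separates qxx xx.
  by exists (V, V'); rewrite ?inE //; split => //=; rewrite VV'.
exists (q @^-1` A, q @^-1` B); rewrite ?inE //; split => /=.
- by apply: open_comp oA => z _; exact: covering_continuous.
- by apply: open_comp oB => z _; exact: covering_continuous.
- by rewrite -preimage_setI AB preimage_set0.
Qed.

Lemma lift_unique (Z : topologicalType) (C : set Z) (f g : Z -> X) z0 :
  connected C ->
  (forall z, C z -> {for z, continuous f}) ->
  (forall z, C z -> {for z, continuous g}) ->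
  (forall z, C z -> q (f z) = q (g z)) ->
  C z0 -> f z0 = g z0 -> forall z, C z -> f z = g z.
Proof.
move=> conC cf cg fg Cz0 fg0.
suff <- : C `&` [set z | f z = g z] = C by move=> z [].
apply: conC; first by exists z0.
(* [C] need not be open; the implication turns agreement on [C] near [z] into a condition on a full
   neighbourhood of [z]. *)
- exists [set z | C z -> f z = g z]°; first exact: open_interior.
  apply/seteqP; split=> z [Cz]; last by move/interior_subset => h; split=> //; exact: h.
  move=> /= fgz; split=> //; have [s sfz] := covering_sheet (f z).
  have sgz : sheet_set s (g z) by rewrite -fgz.
  have nf : nbhs z (f @^-1` sheet_set s).
    by apply: (cf z Cz); exact: open_nbhsW (sheet_set_open s) sfz.
  have ng : nbhs z (g @^-1` sheet_set s).
    by apply: (cg z Cz); exact: open_nbhsW (sheet_set_open s) sgz.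
  apply: filterS2 nf ng => w sfw sgw Cw.
  by rewrite -(sheet_projK sfw) fg // sheet_projK.
- exists (~` [set z | C z -> f z <> g z]°); first exact/open_closedC/open_interior.
  apply/seteqP; split=> z [Cz]; last first.
    move=> nz; split=> //; apply: contrapT => fgz; apply: nz.
    have [V [V' [oV oV' Vf Vg VV']]] := covering_separates (fg z Cz) fgz.
    have nf : nbhs z (f @^-1` V) by apply: (cf z Cz); exact: open_nbhsW.
    have ng : nbhs z (g @^-1` V') by apply: (cg z Cz); exact: open_nbhsW.
    apply: filterS2 nf ng => w Vw V'w Cw fgw.
    have : (V `&` V') (f w) by split=> //; rewrite fgw.
    by rewrite VV'.
  by move=> /= fgz; split => // /interior_subset; apply.
Qed.

End CoveringMaps.

(** * Lifting of paths defined on the whole real line *)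

Section PathLifting.
Context {R : realType} {X Y : topologicalType} {q : X -> Y}.

Definition glue (T : Type) (c : R) (f g : R -> T) (t : R) : T :=
  if t <= c then f t else g t.

Lemma glue_continuous (f g : R -> X) c t :
  (t <= c -> {for t, continuous f}) -> (c <= t -> {for t, continuous g}) ->
  f c = g c -> {for t, continuous (glue c f g)}.
Proof.
move=> cf cg fg; have [tc|ct|tc] := ltgtP t c.
- apply: near_eq_continuous (cf (ltW tc)); near=> u.
  by rewrite /glue ltW //; near: u; exact: lt_nbhsl.
- apply: near_eq_continuous (cg (ltW ct)); near=> u.
  by rewrite /glue leNgt ifF //; apply/negbTE; rewrite negbK; near: u;
    exact: lt_nbhsr.
- move=> A; rewrite /glue tc lexx => nA.
  have nf : nbhs c (f @^-1` A) by move: cf; rewrite tc => cf; apply: cf.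
  have ng : nbhs c (g @^-1` A).
    by move: cg; rewrite tc => cg; apply: cg => //; rewrite -fg.
  by apply: filterS2 nf ng => u fu gu; rewrite /preimage /=; case: ifP.
Unshelve. all: by end_near. Qed.

(** Unlike the base of a sheet around a point, [U] depends on [y] alone and serves every point above
    it. Path lifting needs this: the step length is fixed before the point to continue from is
    known. *)
Lemma covering_section (cq : covering_map q) y :
  exists U : set Y, [/\ open U, U y & forall x, U (q x) ->
    exists s : Y -> X, [/\ forall z, U z -> {for z, continuous s},
      forall z, U z -> q (s z) = z & s (q x) = x]].
Proof.
have [_ _ /(_ y) [U [oU Uy [S [qU _ Ssec]]]]] := cq.
exists U; split=> // x Ux.
have : (q @^-1` U) x by [].
rewrite qU => -[V SV Vx]; have [_ [s [cs _ qs sK]]] := Ssec V SV.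
by exists s; split=> //; exact: sK.
Qed.

Hypothesis cq : covering_map q.
Variables (gamma : R -> Y) (t0 : R) (x0 : X).
Hypothesis cgamma : continuous gamma.
Hypothesis qx0 : q x0 = gamma t0.

(** For [r <= 0] only the initial condition remains, so the property makes sense on all of [R] and
    connectedness of the line can be used. *)
Definition lifts_upto (r : R) (f : R -> X) : Prop :=
  f t0 = x0 /\
  forall t, `|t - t0| < r -> {for t, continuous f} /\ q (f t) = gamma t.

Lemma path_near (U : set Y) t : open U -> U (gamma t) ->
  exists2 e : R, 0 < e & forall u, `|u - t| < e -> U (gamma u).
Proof.
move=> oU Ut; have : nbhs t (gamma @^-1` U).
  by apply: cgamma; exact: open_nbhsW.
move/nbhs_ballP => [e /= e0 eU]; exists e => // u ut; apply: eU.
by rewrite -ball_normE /ball_ /= distrC.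
Qed.

(** Local constancy gives openness and closedness of the set of admissible radii at once. A lift on
    a slightly smaller interval is prolonged at both ends by sections over neighbourhoods of the two
    endpoints. *)
Lemma lifts_upto_locally_constant r : exists2 e : R, 0 < e &
  forall c d, `|c - r| < e -> `|d - r| < e ->
    (exists f, lifts_upto c f) -> exists f, lifts_upto d f.
Proof.
have [s sx0] := covering_sheet cq x0.
have [d0 d0_gt0 d0s] : exists2 e : R, 0 < e &
    forall u, `|u - t0| < e -> sheet_base s (gamma u).
  apply: path_near; first exact: sheet_base_open.
  by rewrite -qx0; exact: sheet_base_image.
have lift0 : lifts_upto d0 (sheet_sec s \o gamma).
  split=> [|t td]; first by rewrite /= -qx0 sheet_projK.
  split; last by rewrite /= sheet_secK.
  apply: continuous_comp; first exact: cgamma.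
  by apply: sheet_sec_continuous; exact: d0s.
have mono c d f : d <= c -> lifts_upto c f -> lifts_upto d f.
  by move=> dc [fx0 h]; split=> // t td; apply: h; apply: lt_le_trans dc.
(* For small [r], negative ones included, a single sheet around [x0] lifts the whole interval. *)
have [rd0|d0r] := ltP r d0.
  exists (d0 - r); first by rewrite subr_gt0.
  move=> c d _ dr _; exists (sheet_sec s \o gamma); apply: mono lift0.
  by move: dr; rewrite ltr_distl => /andP[_ ?]; lra.
have [U1 [oU1 U1r sec1]] := covering_section cq (gamma (t0 + r)).
have [U2 [oU2 U2r sec2]] := covering_section cq (gamma (t0 - r)).
have [e1 e1_gt0 e1U] := path_near oU1 U1r.
have [e2 e2_gt0 e2U] := path_near oU2 U2r.
pose e := Num.min d0 (Num.min e1 e2).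
have e_gt0 : 0 < e by rewrite !lt_min d0_gt0 e1_gt0.
have ed0 : e <= d0 by rewrite ge_min lexx.
have ee1 : e <= e1 by rewrite !ge_min lexx orbT.
have ee2 : e <= e2 by rewrite !ge_min lexx !orbT.
exists e => // c d cr dr [f fc].
have [dc|cd] := leP d c; first by exists f; exact: mono fc.
move: cr dr; rewrite !ltr_distl => /andP[cr1 cr2] /andP[dr1 dr2].
(* The gluing radius lies below [c], where [f] is still a lift, and above [r - e], so that [gamma]
   at [t0 + c'] and [t0 - c'] is already in [U1] and [U2]; it is positive because [e <= d0 <= r]. *)
pose c' := ((r - e) + c) / 2.
have c'1 : r - e < c' by rewrite /c'; lra.
have c'2 : c' < c by rewrite /c'; lra.
have c'0 : 0 < c' by lra.
have [fx0 hf] := fc.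
have /hf [_ qf1] : `|(t0 + c') - t0| < c by rewrite ltr_distl; apply/andP; lra.
have /hf [_ qf2] : `|(t0 - c') - t0| < c by rewrite ltr_distl; apply/andP; lra.
have U1c : U1 (q (f (t0 + c'))).
  by rewrite qf1; apply: e1U; rewrite ltr_distl; apply/andP; lra.
have U2c : U2 (q (f (t0 - c'))).
  by rewrite qf2; apply: e2U; rewrite ltr_distl; apply/andP; lra.
have [s1 [cs1 qs1 s1f]] := sec1 _ U1c.
have [s2 [cs2 qs2 s2f]] := sec2 _ U2c.
have glueE (g1 g2 : R -> X) b : glue b g1 g2 b = g1 b by rewrite /glue lexx.
have glue2 (g1 g2 : R -> X) b u : b < u -> glue b g1 g2 u = g2 u.
  by rewrite /glue ltNge => /negbTE ->.
have glue1 (g1 g2 : R -> X) b u : u <= b -> glue b g1 g2 u = g1 u.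
  by rewrite /glue => ->.
exists (glue (t0 + c') (glue (t0 - c') (s2 \o gamma) f) (s1 \o gamma)); split.
  by rewrite glue1 ?glue2 //; lra.
move=> t; rewrite ltr_distl => /andP[td1 td2]; split.
  apply: glue_continuous => [tc|tc|].
  - apply: glue_continuous => [tc2|tc2|].
    + apply: continuous_comp; first exact: cgamma.
      by apply: cs2; apply: e2U; rewrite ltr_distl; apply/andP; lra.
    + by have [] // := hf t; rewrite ltr_distl; apply/andP; lra.
    + by rewrite /= -qf2 s2f.
  - apply: continuous_comp; first exact: cgamma.
    by apply: cs1; apply: e1U; rewrite ltr_distl; apply/andP; lra.
  - by rewrite glue2 /= -?qf1 ?s1f //; lra.
have [tc|tc] := leP t (t0 + c'); last first.
  by rewrite glue2 //= qs1 //; apply: e1U; rewrite ltr_distl; apply/andP; lra.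
rewrite glue1 //; have [tc2|tc2] := leP t (t0 - c'); last first.
  by rewrite glue2 //; have [] // := hf t; rewrite ltr_distl; apply/andP; lra.
by rewrite glue1 //= qs2 //; apply: e2U; rewrite ltr_distl; apply/andP; lra.
Qed.

Lemma lifts_upto_any r : exists f, lifts_upto r f.
Proof.
suff h : [set r | exists f, lifts_upto r f] = setT :> set R.
  by have : [set: R] r by []; rewrite -h.
have loc := lifts_upto_locally_constant.
have near_ball (P : set R) (x e : R) : 0 < e ->
    (forall c, `|c - x| < e -> P c) -> nbhs x P.
  move=> e0 h; apply/nbhs_ballP; exists e => //= u; rewrite -ball_normE /= distrC.
  exact: h.
have conR : connected [set: R] by apply/connected_intervalP.
apply: conR; first by exists 0, (fun=> x0); split=> // t; rewrite ltNge normr_ge0.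
- exists [set r | exists f, lifts_upto r f]; last by rewrite setTI.
  rewrite openE => x Qx; have [e e0 h] := loc x.
  apply: (near_ball _ _ _ e0) => c cx; apply: (h x c) => //.
  by rewrite subrr normr0.
- exists [set r | exists f, lifts_upto r f]; last by rewrite setTI.
  rewrite -openC openE => x nQx; have [e e0 h] := loc x.
  apply: (near_ball _ _ _ e0) => c cx Qc; apply: nQx; apply: (h c x) Qc => //.
  by rewrite subrr normr0.
Qed.

Lemma path_lifting :
  exists f : R -> X, [/\ continuous f, f t0 = x0 & forall t, q (f t) = gamma t].
Proof.
have [f fP] := choice lifts_upto_any.
have fE r r' t : `|t - t0| < r -> `|t - t0| < r' -> f r t = f r' t.
  move=> tr tr'; pose m := Num.min r r'.
  have conC : connected [set t | `|t - t0| < m].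
    apply/connected_intervalP => x y /=; rewrite !ltr_distl.
    by move=> /andP[? ?] /andP[? ?] z /andP[? ?]; rewrite ltr_distl; apply/andP; lra.
  apply: (@lift_unique _ _ _ cq _ _ (f r) (f r') t0 conC) => [z|z|z| |  |]/=;
    last by rewrite lt_min tr.
  - by rewrite lt_min => /andP[zr _]; exact: ((fP r).2 z zr).1.
  - by rewrite lt_min => /andP[_ zr]; exact: ((fP r').2 z zr).1.
  - rewrite lt_min => /andP[zr zr'].
    by rewrite ((fP r).2 z zr).2 ((fP r').2 z zr').2.
  - rewrite subrr normr0 lt_min.
    by rewrite (le_lt_trans _ tr) // (le_lt_trans _ tr').
  - by rewrite (fP r).1 (fP r').1.
have lt1 t : `|t - t0| < `|t - t0| + 1 by rewrite ltrDl.
(* The lifts for different radii were chosen independently but agree by [fE]. The margin 1 lets one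
   fixed radius serve all points at distance less than 1 from [t], which gives continuity. *)
exists (fun t => f (`|t - t0| + 1) t); split=> [t||t].
- apply: near_eq_continuous ((fP (`|t - t0| + 1)).2 t (lt1 t)).1.
  apply/nbhs_ballP; exists 1 => //= u; rewrite -ball_normE /= distrC => ut.
  apply: fE => //; have -> : u - t0 = (u - t) + (t - t0) by rewrite addrA subrK.
  by rewrite (le_lt_trans (ler_normD _ _)) // addrC ltrD2l.
- by rewrite (fP _).1.
- exact: ((fP _).2 t (lt1 t)).2.
Qed.

End PathLifting.

Section TopologicalQuotient.
Local Open Scope quotient_scope.

(** Only the surjection, its fibres and the final topology are exported, so that nothing later
    depends on the encoding of the quotient type. *)
Lemma topological_quotient (X : topologicalType) (E : X -> X -> Prop) :
  (forall x, E x x) -> (forall x y, E x y -> E y x) ->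
  (forall x y z, E x y -> E y z -> E x z) ->
  exists (Y : topologicalType) (p : X -> Y),
    [/\ forall y, exists x, p x = y, forall x x', p x = p x' <-> E x x' &
        forall U : set Y, open U <-> open (p @^-1` U)].
Proof.
move=> Er Es Et; pose e := fun x y => `[< E x y >].
have eP : equiv_class_of e.
  split=> [x|x y|y x z]; first exact/asboolP.
  - by apply/asboolP/asboolP; exact: Es.
  - by move=> /asboolP xy /asboolP yz; apply/asboolP; exact: Et yz.
pose er := EquivRelPack eP.
exists (quotient_topology {eq_quot er}), \pi; split.
- by move=> y; exists (repr y); exact: reprK.
- move=> x x'; split=> [/eqmodP /asboolP //|xx].
  by apply/eqmodP; exact/asboolP.
- by [].
Qed.

End TopologicalQuotient.

(** * The Riemannian manifold on the total space of a covering *)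

Section LiftedCharts.
Context {R : realType} {n : nat} {M X : topologicalType} {q : X -> M}.
Hypothesis qc : continuous q.

(** The coordinates of a point are those of its image; the sheet enters only through the domain and
    the inverse. Local expressions upstairs are then equal, as functions, to those in [M]. *)
Program Definition lift_chart (c : chart R M n) (s : sheet q) : chart R X n :=
  @Chart R X n (sheet_set s `&` q @^-1` chart_dom c)
    (chart_img c `&` chart_inv c @^-1` sheet_base s)
    (chart_fun c \o q) (sheet_sec s \o chart_inv c) _ _ _ _ _ _ _ _.
Next Obligation.
move=> c s; apply: open_setI_preimage; first exact: sheet_set_open.
  by move=> x _; exact: qc.
exact: chart_dom_open.
Qed.
Next Obligation.
move=> c s; apply: open_setI_preimage; first exact: chart_img_open.
  exact: chart_inv_continuous.
exact: sheet_base_open.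
Qed.
Next Obligation.
move=> c s x [sx cx]; split; first exact: chart_fun_img.
by rewrite /preimage /= chart_funK //; exact: sheet_base_image.
Qed.
Next Obligation.
move=> c s y [cy sy]; split; first exact: sheet_set_sec.
by rewrite /preimage /= sheet_secK; exact: chart_inv_dom.
Qed.
Next Obligation.
by move=> c s x [sx cx] /=; rewrite chart_funK // sheet_projK.
Qed.
Next Obligation.
by move=> c s y [cy sy] /=; rewrite sheet_secK chart_invK.
Qed.
Next Obligation.
move=> c s x [sx cx]; apply: continuous_comp; first exact: qc.
exact: chart_fun_continuous.
Qed.
Next Obligation.
move=> c s y [cy sy]; apply: continuous_comp.
  exact: chart_inv_continuous.
exact: sheet_sec_continuous.
Qed.

Lemma in_charts_proj m (d : chart R M m) (c : chart R M n) (s : sheet q) :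
  in_charts (lift_chart c s) d q = in_charts c d idfun.
Proof. by apply/funext => y; rewrite /in_charts /= sheet_secK. Qed.

Lemma in_charts_dom_proj m (d : chart R M m) (c : chart R M n) (s : sheet q)
    (U : set X) :
  in_charts_dom (lift_chart c s) d U q `<=` in_charts_dom c d setT idfun.
Proof. by move=> y [[cy _] _]; rewrite /= sheet_secK. Qed.

Lemma smooth_transition_lift (c d : chart R M n) (s s' : sheet q) :
  smooth_transition c d -> smooth_transition (lift_chart c s) (lift_chart d s').
Proof.
rewrite /smooth_transition => h.
(* Reading the identity in the lift of [d] is, by conversion, reading [q] in [d]. *)
rewrite -[in_charts _ _ _]/(in_charts (lift_chart c s) d q).
rewrite in_charts_proj; apply: smooth_on_sub h => y [[cy _] _ [_ dy]].
by split=> //; move: dy; rewrite /preimage /= sheet_secK.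
Qed.

End LiftedCharts.

Section CoveringManifold.
Context {R : realType} {n : nat} (M : riemannian_manifold R n).
Context (X : topologicalType) (q : X -> M) (cq : covering_map q).
Hypotheses (X_nonempty : [set: X] !=set0) (X_connected : connected [set: X])
  (X_second_countable : @second_countable X).

Let qc : continuous q := covering_continuous cq.

Program Definition covering_manifold : riemannian_manifold R n :=
  @RiemannianManifold R n X X_nonempty X_connected
    (covering_hausdorff cq (@manifold_hausdorff _ _ M)) X_second_countable
    (atlas_index M * sheet q)%type
    (fun k => lift_chart qc (atlas k.1) k.2) _ _ (fun k => metric k.1) _ _ _ _.
Next Obligation.
move=> x; have [i qxi] := atlas_cover (q x).
by have [s sx] := covering_sheet cq x; exists (i, s).
Qed.
Next Obligation. by move=> *; apply: smooth_transition_lift; exact: atlas_smooth. Qed.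
Next Obligation.
by move=> [i s]; apply: smooth_on_sub (@metric_smooth _ _ M i) => y [].
Qed.
Next Obligation. by move=> [i s] y [iy _]; exact: Defs.metric_sym. Qed.
Next Obligation. by move=> [i s] y [iy _] /= v; exact: metric_pos. Qed.
Next Obligation.
move=> [i s] [j s'] y [[iy _] _ [_ jy]] /=.
have -> : in_charts (lift_chart qc (atlas i) s) (lift_chart qc (atlas j) s')
    idfun = in_charts (atlas i) (atlas j) idfun.
  by apply/funext => z; rewrite /in_charts /= sheet_secK.
rewrite sheet_secK; apply: (@metric_compatible _ _ M i j y); split=> //.
by move: jy; rewrite /preimage /= sheet_secK.
Qed.

Lemma covering_manifold_local_isometry :
  local_isometry (q : covering_manifold -> M).
Proof.
move=> x; have [s sx] := covering_sheet cq x; exists (sheet_set s).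
have oq : open (q @` sheet_set s).
  by apply: covering_open_map => //; exact: sheet_set_open.
split=> //; [exact: sheet_set_open|split|].
- split=> [y _|[i s'] j]; first exact: qc.
  rewrite /= in_charts_proj; apply: smooth_on_sub (@atlas_smooth _ _ M i j).
  exact: in_charts_dom_proj.
- move=> [i s'] j y /= /in_charts_dom_proj yd; rewrite in_charts_proj.
  exact: (@metric_compatible _ _ M i j y).
- exists (sheet_sec s); split; last by move=> z; exact: sheet_projK.
  split=> [_ [y sy <-]|i [j s']].
    by apply: sheet_sec_continuous; exact: sheet_base_image.
  rewrite /= (_ : in_charts _ _ _ = in_charts (atlas i) (atlas j) idfun).
    apply: smooth_on_sub (@atlas_smooth _ _ M i j) => y [iy _ [_ jy]].
    by split=> //; move: jy; rewrite /preimage /= sheet_secK.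
  by apply/funext => y; rewrite /in_charts /= sheet_secK.
Qed.

(** Continuity of [gamma] is a separate clause because a curve with smooth projection may still jump
    between sheets. *)
Lemma smooth_curve_covering J (gamma : R -> X) :
  smooth_curve (M := covering_manifold) J gamma <->
  (forall t, J t -> {for t, continuous gamma}) /\ smooth_curve J (q \o gamma).
Proof.
split=> [[cg sg]|[cg [_ sg]]]; split=> //.
- split=> [t Jt|i]; first by apply: continuous_comp; [exact: cg|exact: qc].
  apply: smooth_on_local => t [Jt it].
  have [s sgt] := covering_sheet cq (gamma t).
  exists (in_chart i (q \o gamma)).
  exists (J `&` gamma @^-1` chart_dom (lift_chart qc (atlas i) s)).
  split; [exact: (sg (i, s))|exact: (conj Jt (conj sgt it))|].
  by apply: filterE.
- move=> [i s]; apply: smooth_on_sub (sg i) => t [Jt [_ it]].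
  by split.
Qed.

Lemma geodesic_covering J (gamma : R -> X) :
  geodesic (M := covering_manifold) J gamma <->
  (forall t, J t -> {for t, continuous gamma}) /\ geodesic J (q \o gamma).
Proof.
split=> [[oJ iJ /smooth_curve_covering [cg sg] eg]|[cg [oJ iJ sg eg]]].
  split=> //; split=> // t i Jt it.
  have [s sgt] := covering_sheet cq (gamma t).
  exact: (eg t (i, s) Jt (conj sgt it)).
split=> //; first exact/smooth_curve_covering.
by move=> t [i s] Jt [_ it]; exact: eg.
Qed.

(** The projected geodesic is extended in [M] and the extension lifted through a point of [gamma];
    uniqueness of lifts on the interval [J] shows that the lift extends [gamma]. *)
Lemma complete_covering : complete_manifold M -> complete_manifold covering_manifold.
Proof.
move=> cM J gamma /geodesic_covering [cg gg].
have [gamma' [gg' gE]] := cM _ _ gg.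
have cg' : continuous gamma'.
  by case: gg' => _ _ [h _] _ t; exact: h.
have [[t0 Jt0]|J0] := pselect (exists t, J t).
  have qg : q (gamma t0) = gamma' t0 by rewrite gE.
  have [f [cf f0 fq]] := path_lifting cq cg' qg.
  exists f; split.
    apply/geodesic_covering; split=> [t _|]; first exact: cf.
    by rewrite (_ : q \o f = gamma') //; exact/funext.
  have conJ : connected J by apply/connected_intervalP; case: gg.
  apply: (@lift_unique _ _ _ cq _ _ f gamma t0 conJ) => // [t _|t Jt].
    exact: cf.
  by rewrite fq gE.
(* Here [J] is empty, and any point above [gamma' 0] may start the lift. *)
have [x0 qx0] := covering_surjective cq (gamma' 0).
have [f [cf f0 fq]] := path_lifting cq cg' qx0.
exists f; split=> [|t Jt]; last by case: J0; exists t.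
apply/geodesic_covering; split=> [t _|]; first exact: cf.
by rewrite (_ : q \o f = gamma') //; exact/funext.
Qed.

End CoveringManifold.

(** * Leaves of the lifted system *)

Section Leaves.
Context {R : realType} {n : nat} {Y : riemannian_manifold R n}.
Context {X : topologicalType}.
Implicit Types (q : X -> Y) (F : set (set Y)).

(** Naming a foil by one of its points makes [leaf] a total function of points, and the lifted
    system becomes its range. *)
Definition foil F (y : Y) : set Y := [set z | exists A, [/\ F A, A y & A z]].

Definition leaf q F (x : X) : set X :=
  connected_component (q @^-1` foil F (q x)) x.

Lemma foilE F A y : is_partition F -> F A -> A y -> foil F y = A.
Proof.
move=> [_ _ Fdisj] FA Ay; apply/seteqP; split=> [z [B [FB By Bz]]|z Az].
  by rewrite (Fdisj A B) //; exists y.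
by exists A.
Qed.

Context {q : X -> Y} {F : set (set Y)}.
Hypothesis partF : is_partition F.

Lemma foil_partition y : F (foil F y) /\ foil F y y.
Proof. by have [_ /(_ y) [A FA Ay] _] := partF; rewrite (foilE partF FA Ay). Qed.

Lemma lifted_systemE : lifted_system q F = range (leaf q F).
Proof.
apply/seteqP; split=> [_ [A [x [FA Aqx ->]]]|_ [x _ <-]].
  by exists x => //; rewrite /leaf (foilE partF FA Aqx).
by have [? ?] := foil_partition (q x); exists (foil F (q x)), x.
Qed.

Lemma leaf_refl x : leaf q F x x.
Proof. by apply: connected_component_refl; exact: (foil_partition _).2. Qed.

Lemma leaf_foil x z : leaf q F x z -> foil F (q x) (q z).
Proof. by move/connected_component_sub. Qed.

Lemma leaf_eq x z : leaf q F x z -> leaf q F x = leaf q F z.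
Proof.
move=> xz; have := leaf_foil xz; move=> xz'; rewrite /leaf.
have -> : foil F (q z) = foil F (q x).
  by apply: foilE => //; exact: (foil_partition _).1.
exact: same_connected_component.
Qed.

Lemma connected_leaf x : connected (leaf q F x).
Proof. exact: component_connected. Qed.

Lemma leaf_partition :
  [/\ forall A, lifted_system q F A -> A !=set0,
      forall x, exists2 A, lifted_system q F A & A x &
      forall A B, lifted_system q F A -> lifted_system q F B ->
        A `&` B !=set0 -> A = B].
Proof.
rewrite lifted_systemE; split=> [_ [x _ <-]|x|_ _ [x _ <-] [y _ <-] [z [xz yz]]].
- by exists x; exact: leaf_refl.
- by exists (leaf q F x); [exists x|exact: leaf_refl].
- by rewrite (leaf_eq xz) (leaf_eq yz).
Qed.

End Leaves.

Section LeafMaps.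
Context {R : realType} {n : nat} {Y : riemannian_manifold R n}.
Context {X X' : topologicalType} {q : X -> Y} {q' : X' -> Y}.
Context {F : set (set Y)}.
Hypothesis partF : is_partition F.

(** The image of a leaf is connected and lies over the same foil, so it stays within one
    component. *)
Lemma leaf_map (f : X -> X') x z : continuous f -> q' \o f = q ->
  leaf q F x z -> leaf q' F (f x) (f z).
Proof.
move=> cf qf xz.
have sub : f @` leaf q F x `<=` leaf q' F (f x).
  apply: connected_component_max.
  - by exists x => //; exact: leaf_refl.
  - move=> _ [w /leaf_foil xw <-]; rewrite /preimage /=.
    by rewrite -[q' (f w)]/((q' \o f) w) -[q' (f x)]/((q' \o f) x) qf.
  - by apply: connected_image => [y _|]; [exact: cf|exact: connected_leaf].
by apply: sub; exists z.
Qed.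

End LeafMaps.

Lemma leaf_homeo (R : realType) n (Y : riemannian_manifold R n)
    (X X' : topologicalType) (q : X -> Y) (q' : X' -> Y)
    (F : set (set Y)) (f : X -> X') (g : X' -> X) x :
  is_partition F -> continuous f -> continuous g -> cancel f g -> cancel g f ->
  q' \o f = q -> f @` leaf q F x = leaf q' F (f x).
Proof.
move=> pF cf cg fK gK qf; apply/seteqP; split=> [_ [z xz <-]|z xz].
  exact: (leaf_map pF cf qf xz).
exists (g z); last exact: gK.
rewrite -(fK x); apply: (leaf_map pF cg _ xz).
by apply/funext => w; rewrite -qf /= gK.
Qed.

(** * Local connectedness of manifolds and of embedded foils *)

Section LocalConnectedness.
Context {R : realType}.

Lemma starshaped_connected (V : normedModType R) (A : set V) (a : V) :
  A a -> (forall b t, A b -> 0 <= t <= 1 -> A (a + t *: (b - a))) ->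
  connected A.
Proof.
move=> Aa star.
have -> : A = \bigcup_(b in A) ((fun t : R => a + t *: (b - a)) @` `[0, 1]).
  apply/seteqP; split=> [b Ab|z [b Ab [t t01 <-]]]; last first.
    by apply: star => //; rewrite in_itv in t01.
  exists b => //; exists 1; first by rewrite /= in_itv /= lexx ler01.
  by rewrite scale1r addrC subrK.
apply: bigcup_connected.
  exists a => b Ab; exists 0; first by rewrite /= in_itv /= lexx ler01.
  by rewrite scale0r addr0.
move=> b Ab; apply: connected_image; last exact: segment_connected.
move=> t _; apply: cvgD; first exact: cvg_cst.
by apply: cvgZr_tmp; exact: cvg_id.
Qed.

(** In the slice chart [S] becomes a coordinate subspace, which meets a ball centred on it in a
    star-shaped set. *)
Lemma slice_connected (X : topologicalType) n (c : chart R X n) (k : nat)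
    (S U : set X) x :
  (forall z, chart_dom c z ->
     S z <-> forall a : 'I_n, (k <= a)%N -> chart_fun c z 0 a = 0) ->
  chart_dom c x -> S x -> open U -> U x ->
  exists W, [/\ open W, W x, W `<=` U & connected (W `&` S)].
Proof.
move=> slice cx Sx oU Ux.
pose D := chart_img c `&` chart_inv c @^-1` U.
have oD : open D.
  apply: open_setI_preimage => //; first exact: chart_img_open.
  exact: chart_inv_continuous.
have Dx : D (chart_fun c x).
  by split; [exact: chart_fun_img|rewrite /preimage /= chart_funK].
have /nbhs_ballP [e /= e0 eD] : nbhs (chart_fun c x) D by exact: open_nbhsW.
pose B := ball (chart_fun c x) e.
pose L := [set y : 'rV[R]_n | forall a : 'I_n, (k <= a)%N -> y 0 a = 0].
exists (chart_dom c `&` chart_fun c @^-1` B); split.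
- apply: open_setI_preimage; first exact: chart_dom_open.
    exact: chart_fun_continuous.
  exact: ball_open.
- by split=> //; exact: ballxx.
- by move=> z [cz /eD [_]]; rewrite /preimage /= chart_funK.
have -> : (chart_dom c `&` chart_fun c @^-1` B) `&` S = chart_inv c @` (B `&` L).
  apply/seteqP; split=> [z [[cz Bz] Sz]|_ [y [By Ly] <-]].
    exists (chart_fun c z); last exact: chart_funK.
    by split=> //; exact/slice.
  have [iy _] := eD _ By.
  have cy := chart_inv_dom iy.
  split; first by split=> //; rewrite /preimage /= chart_invK.
  by apply/slice => // a ka; rewrite chart_invK //; exact: Ly.
apply: connected_image.
  by move=> y [/eD [iy _] _]; exact: chart_inv_continuous.
have Lx : L (chart_fun c x) by exact/slice.
apply: (starshaped_connected (a := chart_fun c x)); first by split; [exact: ballxx|].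
move=> b t [Bb Lb] /andP[t0 t1]; split; last first.
  by move=> a ka; rewrite !mxE Lb // Lx // subr0 mulr0 addr0.
move: Bb; rewrite /B -ball_normE /= opprD addrA subrr add0r normrN normrZ.
rewrite -normrN opprB ger0_norm //; apply: le_lt_trans.
by rewrite ler_piMl.
Qed.

Lemma manifold_locally_connected n (M : riemannian_manifold R n) (U : set M) x :
  open U -> U x -> exists W, [/\ open W, W x, W `<=` U & connected W].
Proof.
move=> oU Ux; have [i ix] := atlas_cover x.
have [|W [oW Wx WU]] :=
  (* With [k = n] the slice equations are vacuous, so the lemma applies to the whole manifold. *)
  slice_connected (k := n) (S := setT) (c := atlas i) _ ix I oU Ux.
  by move=> z _; split=> // _ a; rewrite leqNgt ltn_ord.
by rewrite setIT => cW; exists W.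
Qed.

Lemma leaf_open n (M : riemannian_manifold R n) (X : topologicalType)
    (q : X -> M) (F : set (set M)) x :
  covering_map q -> embedded_transnormal_system F ->
  exists W, [/\ open W, W x &
    forall z, W z -> foil F (q x) (q z) -> leaf q F x z].
Proof.
move=> cq [pF emb _]; have [FA Aqx] := foil_partition pF (q x).
set A := foil F (q x) in FA Aqx *.
have [_ [k [_ /(_ _ Aqx) [c [_ cx slice]]]]] := emb _ FA.
have [s sx] := covering_sheet cq x.
(* Taking [W] inside the base of a sheet keeps the section continuous on the connected plaque [W]
   meets [A], whose lift then lies in the leaf of [x]. *)
have [W [oW Wx Ws conW]] := slice_connected slice cx Aqx
  (sheet_base_open s) (sheet_base_image sx).
exists (sheet_set s `&` q @^-1` W); split=> //.
  apply: open_setI_preimage => //; first exact: sheet_set_open.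
  by move=> z _; exact: covering_continuous.
move=> z [sz Wz] Az.
have sub : sheet_sec s @` (W `&` A) `<=` leaf q F x.
  apply: connected_component_max.
  - by exists (q x) => //; rewrite sheet_projK.
  - by move=> _ [y [_ Ay] <-]; rewrite /preimage /= sheet_secK.
  - by apply: connected_image => // y [/Ws sy _]; exact: sheet_sec_continuous.
by apply: sub; exists (q z) => //; rewrite sheet_projK.
Qed.

End LocalConnectedness.

(** * The lifted system is again an embedded transnormal system *)

Section CoveringTransnormal.
Context {R : realType} {n : nat} (M : riemannian_manifold R n).
Context (X : topologicalType) (q : X -> M) (cq : covering_map q).
Hypotheses (X_nonempty : [set: X] !=set0) (X_connected : connected [set: X])
  (X_second_countable : @second_countable X).
Context (F : set (set M)) (transF : embedded_transnormal_system F).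

Let N := covering_manifold cq X_nonempty X_connected X_second_countable.
Let partF : is_partition F. Proof. by case: transF. Qed.

Lemma leaf_embedded x : exists k, embedded_submanifold (M := N) k (leaf q F x).
Proof.
have [_ emb _] := transF; have [FA Aqx] := foil_partition partF (q x).
have [_ [k [kn slice]]] := emb _ FA.
exists k; split=> // z xz.
have [c [cc cz cslice]] := slice _ (leaf_foil xz).
have [s sz] := covering_sheet cq z.
have [W [oW Wz Wleaf]] := leaf_open z cq transF.
(* The lifted slice equations describe the whole preimage of the foil; restricting the sheet to [W]
   excludes its other components. *)
exists (lift_chart (covering_continuous cq) c (sheet_restrict s oW)); split=> //.
  by move=> [i s']; split; apply: smooth_transition_lift; have [] := cc i.
move=> w [[sw Ww] cw]; rewrite (leaf_eq partF xz).
have fzx : foil F (q z) = foil F (q x).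
  by apply: foilE partF FA _; exact: leaf_foil xz.
split=> [/leaf_foil zw|h]; first by apply/(cslice _ cw); rewrite -fzx.
by apply: Wleaf => //; rewrite fzx; exact/(cslice _ cw).
Qed.

(** In lifted coordinates the leaf and the foil have the same tangent vectors: curves in the leaf
    project to the foil, and short curves in the foil lift through a section. *)
Lemma orthogonal_covering (gamma : R -> X) t :
  orthogonal_at (M := N) (leaf q F (gamma t)) gamma t <->
  orthogonal_at (foil F (q (gamma t))) (q \o gamma) t.
Proof.
have [FA Aqx] := foil_partition partF (q (gamma t)).
split=> [orth i it v [e [sigma [e0 ssigma sigma0 sigmaA vE]]]|
         orth [i s] [st it] v [e [sigma [e0 ssigma sigma0 sigmaA vE]]]].
- have [s sx] := covering_sheet cq (gamma t).
  have csigma u : `]- e, e[%classic u -> {for u, continuous sigma}.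
    by case: ssigma => h _; exact: h.
  have e0' : `]- e, e[%classic 0 by rewrite /= in_itv /= oppr_lt0 e0.
  have nb : nbhs 0 (sigma @^-1` sheet_base s).
    apply: (csigma 0 e0'); apply: open_nbhsW; first exact: sheet_base_open.
    by rewrite sigma0; exact: sheet_base_image.
  have [e1 /= e1_gt0 e1s] := (nbhs_ballP _ _).1 nb.
  (* The curve is shortened to stay over the sheet; its derivative at 0 is unaffected. *)
  pose d := Num.min e e1.
  have d0 : 0 < d by rewrite lt_min e0.
  have de : `]- d, d[ `<=` `]- e, e[.
    move=> u /=; rewrite !in_itv /= => /andP[u1 u2].
    have dle : d <= e by rewrite ge_min lexx.
    by rewrite (lt_le_trans u2) // (le_lt_trans _ u1) // lerN2.
  have ds u : `]- d, d[%classic u -> sheet_base s (sigma u).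
    rewrite /= in_itv /= => /andP[u1 u2]; apply: e1s.
    rewrite -ball_normE /= sub0r normrN ltr_norml.
    have dle : d <= e1 by rewrite ge_min lexx orbT.
    by rewrite (lt_le_trans u2) // (le_lt_trans _ u1) // lerN2.
  have ctau u : `]- d, d[%classic u -> {for u, continuous (sheet_sec s \o sigma)}.
    move=> du; apply: continuous_comp; first exact/csigma/de.
    exact/sheet_sec_continuous/ds.
  have qtau : q \o (sheet_sec s \o sigma) = sigma.
    by apply/funext => u /=; rewrite sheet_secK.
  have tau0 : sheet_sec s (sigma 0) = gamma t.
    by rewrite sigma0 /= sheet_projK.
  have d0' : `]- d, d[%classic 0 by rewrite /= in_itv /= oppr_lt0 d0.
  apply: (orth (i, s) (conj sx it) v).
  exists d, (sheet_sec s \o sigma); split=> //.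
  + apply/smooth_curve_covering; split=> //; rewrite qtau.
    case: ssigma => cs ss; split=> [u /de|j]; first exact: cs.
    by apply: smooth_on_sub (ss j) => u [/de ? ?]; split.
  (* Lying over the foil is not enough to be in the leaf; the lifted curve is also connected and
     passes through [gamma t]. *)
  + have sub : (sheet_sec s \o sigma) @` `]- d, d[ `<=` leaf q F (gamma t).
      apply: connected_component_max; first by exists 0.
        move=> _ [u /de /sigmaA Au <-].
        by rewrite /preimage /= sheet_secK.
      apply: connected_image => //.
      exact/connected_intervalP/interval_is_interval.
    by move=> u du; apply: sub; exists u.
  + by rewrite vE -[in LHS]qtau.
- apply: (orth i it v); exists e, (q \o sigma); split=> //.
  + by move/smooth_curve_covering: ssigma => [].
  + by rewrite /= sigma0.
  + by move=> u /sigmaA /leaf_foil.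
Qed.

Lemma transnormal_covering :
  embedded_transnormal_system (M := N) (lifted_system q F).
Proof.
split.
- exact: leaf_partition.
- move=> A; rewrite (lifted_systemE partF) => -[x _ <-].
  by split; [exact: connected_leaf|exact: leaf_embedded].
- move=> J gamma /geodesic_covering [cg gg]; have [_ _ dich] := transF.
  have leafE t A : lifted_system q F A -> A (gamma t) -> A = leaf q F (gamma t).
    by rewrite (lifted_systemE partF) => -[x _ <-]; exact: leaf_eq.
  have FP t := foil_partition partF (q (gamma t)).
  have [orth|north] := dich J _ gg; [left|right] => t A Jt FA Agt;
      rewrite (leafE t A FA Agt).
    by apply/orthogonal_covering; apply: orth => //; have [] := FP t.
  by move/orthogonal_covering; apply: north => //; have [] := FP t.
Qed.

End CoveringTransnormal.

(** * The quotient by the leaf-preserving deck transformations *)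

Section DeckTransformations.
Context {X Y : topologicalType} {q : X -> Y}.

Lemma deck_comp g g' : covering_transformation q g ->
  covering_transformation q g' -> covering_transformation q (g \o g').
Proof.
move=> [cg qg [h [ch gK hK]]] [cg' qg' [h' [ch' gK' hK']]]; split.
- by move=> x; apply: continuous_comp; [exact: cg'|exact: cg].
- by rewrite compA qg.
- exists (h' \o h); split; [|exact: can_comp|exact: can_comp].
  by move=> x; apply: continuous_comp; [exact: ch|exact: ch'].
Qed.

Lemma deck_inverse g : covering_transformation q g ->
  exists h, [/\ covering_transformation q h, cancel g h & cancel h g].
Proof.
move=> [cg qg [h [ch gK hK]]]; exists h; split=> //; split=> //.
  by apply/funext => x; rewrite -{1}qg /= hK.
by exists g.
Qed.

Lemma deck_fiber g x : covering_transformation q g -> q (g x) = q x.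
Proof. by case=> _ qg _; rewrite -[RHS](congr1 (@^~ x) qg). Qed.

Lemma deck_continuous g : covering_transformation q g -> continuous g.
Proof. by case. Qed.

Lemma deck_unique (g g' : X -> X) x : covering_map q -> connected [set: X] ->
  covering_transformation q g -> covering_transformation q g' ->
  g x = g' x -> g = g'.
Proof.
move=> cq conX dg dg' gx; apply/funext => z.
apply: (@lift_unique _ _ _ cq _ [set: X] g g' x) => // w _.
- exact: (deck_continuous dg).
- exact: (deck_continuous dg').
- by rewrite !deck_fiber.
Qed.

End DeckTransformations.

Lemma deck_factor (X Y Z : topologicalType) (p : X -> Y) (q : Y -> Z) g :
  covering_transformation p g -> covering_transformation (q \o p) g.
Proof. by case=> cg pg hg; split=> //; rewrite -compA pg. Qed.

Section LeafPreservingDecks.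
Context {R : realType} {n : nat} (M : riemannian_manifold R n).
Context {X : topologicalType} (q : X -> M) (F : set (set M)).
Hypothesis partF : is_partition F.

(** The group [N], stated pointwise: deck transformations permute leaves, so moving every point
    within its leaf amounts to fixing every leaf ([leaf_deckP]). *)
Definition leaf_deck (g : X -> X) : Prop :=
  covering_transformation q g /\ forall x, leaf q F x (g x).

Lemma leaf_sym x z : leaf q F x z -> leaf q F z x.
Proof. by move=> xz; rewrite -(leaf_eq partF xz); exact: leaf_refl. Qed.

Lemma deck_leaf g x : covering_transformation q g ->
  g @` leaf q F x = leaf q F (g x).
Proof. by case=> cg qg [h [ch gK hK]]; exact: (leaf_homeo x partF cg ch gK hK qg). Qed.

Lemma leaf_deckP g : covering_transformation q g ->
  leaf_deck g <-> forall A, lifted_system q F A -> g @` A = A.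
Proof.
move=> dg; rewrite (lifted_systemE partF); split=> [[_ gl] _ [x _ <-]|h].
  by rewrite deck_leaf // -(leaf_eq partF (gl x)).
split=> // x; have := h (leaf q F x) (ex_intro2 _ _ x I erefl).
by rewrite deck_leaf // => <-; exact: leaf_refl.
Qed.

Lemma leaf_deck_id : leaf_deck idfun.
Proof.
split; last by move=> x; exact: leaf_refl.
have cid : continuous (idfun : X -> X) by move=> x; exact: cvg_id.
by split=> //; exists idfun.
Qed.

Lemma leaf_deck_comp g g' : leaf_deck g -> leaf_deck g' -> leaf_deck (g \o g').
Proof.
move=> [dg gl] [dg' gl']; split; first exact: deck_comp.
by move=> x; rewrite (leaf_eq partF (gl' x)); exact: gl.
Qed.

Lemma leaf_deck_inverse g : leaf_deck g ->
  exists h, [/\ leaf_deck h, cancel g h & cancel h g].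
Proof.
move=> [dg gl]; have [h [dh gK hK]] := deck_inverse dg.
exists h; split=> //; split=> // x; apply: leaf_sym.
by rewrite -{2}(hK x); exact: gl.
Qed.

(** Normality in the form that lets [f] descend: it maps orbits of [N] into orbits of [N]. *)
Lemma leaf_deck_normal f g : covering_transformation q f -> leaf_deck g ->
  exists2 g', leaf_deck g' & forall x, f (g x) = g' (f x).
Proof.
move=> df [dg gl]; have [h [dh fK hK]] := deck_inverse df.
exists (f \o g \o h); last by move=> x /=; rewrite fK.
split=> [|x]; first by apply: deck_comp => //; exact: deck_comp.
rewrite -{1}(hK x) -deck_leaf //; by exists (g (h x)).
Qed.

End LeafPreservingDecks.

(** * The two coverings into which the quotient by [N] splits [q] *)

Section LeafQuotient.
Context {R : realType} {n : nat} (M Mhat : riemannian_manifold R n).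
Context (q : Mhat -> M) (F : set (set M)).
Hypotheses (rq : regular_covering q) (partF : is_partition F).
Context (X : topologicalType) (p : Mhat -> X).
Hypotheses (p_surjective : forall y, exists x, p x = y)
  (pE : forall x x', p x = p x' <-> exists2 g, leaf_deck q F g & g x = x')
  (p_quotient : forall U : set X, open U <-> open (p @^-1` U)).

Let cq : covering_map q := rq.1.
Let qc : continuous q := covering_continuous cq.
Let conMhat : connected [set: Mhat] := @manifold_connected _ _ Mhat.

Lemma quotient_map_continuous : continuous p.
Proof. by apply/continuousP => U /p_quotient. Qed.

Lemma quotient_map_open (U : set Mhat) : open U -> open (p @` U).
Proof.
move=> oU; apply/p_quotient; apply: open_local => x [z Uz /pE [g gd gz]].
have [h [[dh hl] gK hK]] := leaf_deck_inverse partF gd.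
exists (h @^-1` U); split.
- by apply: open_comp oU => w _; exact: (deck_continuous dh).
- by rewrite /preimage /= -gz gK.
- by move=> w Uhw; exists (h w) => //; apply/pE; exists g.
Qed.

Lemma quotient_map_descent (Z : topologicalType) (f : X -> Z) :
  continuous (f \o p) -> continuous f.
Proof.
move=> /continuousP cfp; apply/continuousP => U oU.
by apply/p_quotient; exact: cfp.
Qed.

Lemma quotient_leaf_deck g x : leaf_deck q F g -> p (g x) = p x.
Proof. by move=> gd; apply/esym/pE; exists g. Qed.

Lemma quotient_projection : exists pi : X -> M, pi \o p = q.
Proof.
have [r rK] := choice p_surjective.
exists (q \o r); apply/funext => x /=.
have /pE [g [dg _] gx] := rK (p x).
by rewrite -[in RHS]gx (deck_fiber _ dg).
Qed.

Context (pi : X -> M) (pip : pi \o p = q).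

Let piE x : pi (p x) = q x. Proof. by rewrite -pip. Qed.

Lemma quotient_projection_continuous : continuous pi.
Proof. by apply: quotient_map_descent; rewrite pip. Qed.

(** The sheets over the image of one sheet [V] of [q] are the translates of [V] under [N]. Two that
    meet are equal, since [q] is injective on [V] and a deck transformation is determined by one
    value; the section into [g V] runs down by [pi], up by [s], then across by [g]. *)
Lemma quotient_map_covering : covering_map p.
Proof.
split; [exact: quotient_map_continuous|exact: p_surjective|].
move=> y; have [x <-] := p_surjective y.
have [_ _ /(_ (q x)) [U [oU Uqx [S [qU _ Ssec]]]]] := cq.
have : (q @^-1` U) x by [].
rewrite qU => -[V SV Vx]; have [oV [s [cs sV qs sK]]] := Ssec V SV.
have VU z : V z -> U (q z) by move=> Vz; suff: (q @^-1` U) z by []; rewrite qU; exists V.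
exists (p @` V); split; [exact: quotient_map_open|by exists x|].
exists [set g @` V | g in leaf_deck q F]; split.
- apply/seteqP; split=> [z [v Vv /pE [g gd gv]]|z [_ [g gd <-] [v Vv <-]]].
    by exists (g @` V); [exists g|exists v].
  by exists v => //; rewrite quotient_leaf_deck.
- move=> _ _ [g [dg gl] <-] [g' [dg' gl'] <-] [_ [[v Vv <-] [v' Vv' gv]]].
  have vv : v' = v.
    by rewrite -(sK v) // -(sK v') // -(deck_fiber v' dg') gv (deck_fiber v dg).
  by rewrite (deck_unique cq conMhat dg' dg (x := v)) // -{1}vv.
- move=> _ [g [dg gl] <-]; split.
    have [h [dh gK hK]] := deck_inverse dg.
    have -> : g @` V = h @^-1` V.
      apply/seteqP; split=> [_ [v Vv <-]|z Vhz]; first by rewrite /preimage /= gK.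
      by exists (h z).
    by apply: open_comp oV => w _; exact: (deck_continuous dh).
  exists (g \o s \o pi); split.
  + move=> _ [v Vv <-]; apply: continuous_comp.
      exact: quotient_projection_continuous.
    rewrite piE; apply: continuous_comp; first exact/cs/VU.
    exact: (deck_continuous dg).
  + by move=> _ [v Vv <-] /=; exists v => //; rewrite piE sK.
  + by move=> _ [v Vv <-] /=; rewrite piE sK // quotient_leaf_deck.
  + by move=> _ [v Vv <-] /=; rewrite piE (deck_fiber v dg) sK.
Qed.

(** The element of [N] that moves [x] to [g x] may a priori depend on [x], which is harmless because
    [leaf_deck] is a pointwise condition. *)
Lemma quotient_deckP g : covering_transformation p g <-> leaf_deck q F g.
Proof.
split=> [dg|gd].
  split; first by rewrite -pip; exact: deck_factor.
  move=> x; have /esym/pE [h [_ hl] <-] := deck_fiber x dg.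
  exact: hl.
have [[cg _ hg] _] := gd; split=> //.
by apply/funext => x; exact: quotient_leaf_deck.
Qed.

Lemma quotient_map_regular : regular_covering p.
Proof.
split; first exact: quotient_map_covering.
by move=> x x' /pE [g /quotient_deckP gd gx]; exists g.
Qed.

Lemma deck_descends f : covering_transformation q f ->
  exists2 phi, covering_transformation pi phi & forall x, phi (p x) = p (f x).
Proof.
move=> df; have [r rK] := choice p_surjective.
(* By normality [p \o f'] is constant on the fibres of [p], so the arbitrary choice [r] of
   representatives does not matter. *)
have desc f' : covering_transformation q f' ->
    forall x, p (f' (r (p x))) = p (f' x).
  move=> df' x; have /pE [g gd <-] := esym (rK (p x)).
  have [g' gd' ->] := leaf_deck_normal partF df' gd.
  exact: quotient_leaf_deck.
have [h [dh fK hK]] := deck_inverse df.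
have descc f' : covering_transformation q f' -> continuous (p \o f' \o r).
  move=> df'; apply: quotient_map_descent.
  have -> : p \o f' \o r \o p = p \o f' by apply/funext => x /=; exact: desc.
  move=> x; apply: continuous_comp; first exact: (deck_continuous df').
  exact: quotient_map_continuous.
exists (p \o f \o r); last by move=> x; exact: desc.
split; first exact: descc.
  apply/funext => y; have [x <-] := p_surjective y.
  by rewrite /= desc // !piE (deck_fiber _ df).
exists (p \o h \o r); split; first exact: descc.
  by move=> y; have [x <-] := p_surjective y; rewrite /= (desc h) // fK rK.
by move=> y; have [x <-] := p_surjective y; rewrite /= (desc f) // hK rK.
Qed.

Lemma quotient_projection_covering : covering_map pi.
Proof.
split; first exact: quotient_projection_continuous.
  by move=> y; have [x <-] := covering_surjective cq y; exists (p x).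
move=> y; have [U0 [oU0 U0y sec]] := covering_section cq y.
(* Connectedness of [U] makes sheets equal or disjoint: two sections related by an element of [N] at
   one point are related by it on all of [U]. *)
have [U [oU Uy UU0 conU]] := manifold_locally_connected oU0 U0y.
pose section_over (s : M -> Mhat) :=
  (forall z, U z -> {for z, continuous s}) /\ (forall z, U z -> q (s z) = z).
exists U; split=> //; exists [set p @` (s @` U) | s in section_over]; split.
- apply/seteqP; split=> [z Uz|z [_ [s [_ qs] <-] [_ [u Uu <-] <-]]]; last first.
    by rewrite /preimage /= piE qs.
  have [x xz] := p_surjective z; move: Uz; rewrite -xz /preimage /= piE => Ux.
  have [s [cs qs sx]] := sec x (UU0 _ Ux).
  exists (p @` (s @` U)); last by exists x => //; exists (q x).
  by exists s => //; split=> w /UU0; [exact: cs|exact: qs].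
- move=> _ _ [s [cs qs] <-] [s' [cs' qs'] <-].
  move=> [_ [[_ [u Uu <-] <-] [_ [u' Uu' <-] psu]]].
  have uu : u' = u by rewrite -(qs u Uu) -piE -psu piE qs'.
  move: psu; rewrite uu => /esym /pE [g gd gs].
  have sE z : U z -> g (s z) = s' z.
    apply: (@lift_unique _ _ _ cq _ U (g \o s) s' u) => // w Uw.
    - apply: continuous_comp; first exact: cs.
      exact: (deck_continuous gd.1).
    - by rewrite /= (deck_fiber _ gd.1) qs // qs'.
  apply/seteqP; split=> _ [_ [w Uw <-] <-].
    by rewrite -(quotient_leaf_deck _ gd) sE //; exists (s' w) => //; exists w.
  by rewrite -sE // quotient_leaf_deck //; exists (s w) => //; exists w.
- move=> _ [s [cs qs] <-]; split.
    apply: quotient_map_open; apply: open_local => _ [u Uu <-].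
    (* To see that [s] has open image: a point [z] near [s u] shares the sheet [t] with [s (q z)],
       and both have the same projection, so they coincide. *)
    have [t tsu] := covering_sheet cq (s u).
    have oUs : open (U `&` s @^-1` sheet_set t).
      by apply: open_setI_preimage => //; exact: sheet_set_open.
    exists (sheet_set t `&` q @^-1` (U `&` s @^-1` sheet_set t)); split.
    + apply: open_setI_preimage => //; first exact: sheet_set_open.
      by move=> z _; exact: qc.
    + by split=> //; rewrite /preimage /= qs.
    + move=> z [tz [Uqz tsqz]]; exists (q z) => //.
      by rewrite -(sheet_projK tsqz) qs // sheet_projK.
  exists (p \o s); split.
  + move=> z Uz; apply: continuous_comp; first exact: cs.
    exact: quotient_map_continuous.
  + by move=> z Uz; exists (s z) => //; exists z.
  + by move=> z Uz; rewrite /= piE qs.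
  + by move=> _ [_ [u Uu <-] <-]; rewrite /= piE qs.
Qed.

Lemma quotient_projection_regular : regular_covering pi.
Proof.
split; first exact: quotient_projection_covering.
move=> y y'; have [x <-] := p_surjective y; have [x' <-] := p_surjective y'.
rewrite !piE => /(rq.2) [f df fx]; have [phi dphi phiE] := deck_descends df.
by exists phi => //; rewrite phiE fx.
Qed.

Lemma quotient_nonempty : [set: X] !=set0.
Proof. by have [x _] := @manifold_nonempty _ _ Mhat; exists (p x). Qed.

Lemma quotient_connected : connected [set: X].
Proof.
have -> : [set: X] = p @` [set: Mhat].
  by apply/seteqP; split=> // y _; have [x <-] := p_surjective y; exists x.
by apply: connected_image => // x _; exact: quotient_map_continuous.
Qed.

Lemma quotient_second_countable : @second_countable X.
Proof.
have [B cB [Bopen Bbasis]] := @manifold_second_countable _ _ Mhat.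
exists [set p @` U | U in B]; first by apply: sub_countable cB; exact: card_image_le.
split=> [_ [U /Bopen oU <-]|y A]; first exact: quotient_map_open.
have [x <-] := p_surjective y => nA.
have : nbhs x (p @^-1` A) by exact: quotient_map_continuous.
move=> /Bbasis [U [BU Ux] UA]; exists (p @` U).
  by split; [exists U|exists x].
by move=> _ [z /UA Az <-].
Qed.

Hypothesis transF : embedded_transnormal_system F.

Lemma quotient_leaf x : p @` leaf q F x = leaf pi F (p x).
Proof.
have lpi z : leaf q F x z -> leaf pi F (p x) (p z).
  exact: (leaf_map partF quotient_map_continuous pip).
have qfoil z w : leaf q F x w -> leaf pi F (p x) (p z) -> foil F (q w) (q z).
  move=> xw /leaf_foil; rewrite !piE.
  have -> // : foil F (q w) = foil F (q x).
  by apply: foilE partF (foil_partition partF _).1 _; exact: leaf_foil.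
have [W WP] := choice (fun z => leaf_open z cq transF).
have oW z : open (W z) by case: (WP z).
have Wz z : W z z by case: (WP z).
have Wleaf z w : W z w -> foil F (q z) (q w) -> leaf q F z w.
  by case: (WP z) => _ _; exact.
apply: connected_leaf; first by exists (p x), x => //; exact: leaf_refl.
- exists (\bigcup_(z in leaf q F x) (p @` W z)).
    by apply: bigcup_open => z _; exact: quotient_map_open.
  apply/seteqP; split=> [_ [z xz <-]|y [Ly [z xz [w Wzw wy]]]].
    by split; [exact: lpi|exists z => //; exists z].
  exists w => //; rewrite (leaf_eq partF xz); apply: Wleaf => //.
  by apply: qfoil => //; rewrite wy.
(* If the image of [W z'] met the image of the leaf of [x], an element of [N] would put a point [w]
   of [W z'] in that leaf, and then [z'] too, being in the leaf of [w]. *)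
- exists (~` \bigcup_(z in ~` leaf q F x `&` p @^-1` leaf pi F (p x)) (p @` W z)).
    by apply/open_closedC/bigcup_open => z _; exact: quotient_map_open.
  apply/seteqP; split=> [_ [z xz <-]|y [xy ny]]; last first.
    have [z zy] := p_surjective y; rewrite -zy in xy ny *.
    exists z => //; apply: contrapT => nxz; apply: ny.
    by exists z => //; exists z.
  split; first exact: lpi.
  move=> [z' [nxz' xz'] [w Wz'w /pE [g [dg gl] gw]]]; apply: nxz'.
  have xw : leaf q F x w.
    by rewrite (leaf_eq partF xz) -gw; apply: (leaf_sym partF); exact: gl.
  rewrite (leaf_eq partF xw); apply: (leaf_sym partF); apply: Wleaf => //.
  have -> : foil F (q z') = foil F (q x).
    apply: foilE partF (foil_partition partF _).1 _.
    by have := qfoil z' x (leaf_refl partF x) xz'.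
  exact: leaf_foil.
Qed.

Lemma quotient_leaf_preimage x : p @^-1` leaf pi F (p x) = leaf q F x.
Proof.
rewrite -quotient_leaf; apply/seteqP; split=> [z [w xw /pE [g [_ gl] <-]]|z xz].
  by rewrite (leaf_eq partF xw).
by exists z.
Qed.

End LeafQuotient.

(** * Comparing two decompositions *)

Section DeckTransport.
Context {X Y Z : topologicalType} {p : X -> Y} {q : Y -> Z}.
Hypotheses (pc : continuous p) (cq : covering_map q) (conX : connected [set: X]).

(** Both composites lift [q \o p] through [q], so agreement at one point spreads over the connected
    space [X]. *)
Lemma deck_intertwine phi g x :
  covering_transformation q phi -> covering_transformation (q \o p) g ->
  phi (p x) = p (g x) -> phi \o p = p \o g.
Proof.
move=> dphi dg px; apply/funext => z.
apply: (@lift_unique _ _ _ cq _ [set: X] (phi \o p) (p \o g) x) => // w _.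
- apply: continuous_comp; first exact: pc.
  exact: (deck_continuous dphi).
- apply: continuous_comp; last exact: pc.
  exact: (deck_continuous dg).
- rewrite /= (deck_fiber _ dphi).
  by rewrite -[RHS]/((q \o p) (g w)) (deck_fiber _ dg).
Qed.

End DeckTransport.

(** * Local isometries and the metric read through a covering *)

Section LocalIsometries.
Context {R : realType} {n : nat}.
Implicit Types X Y : riemannian_manifold R n.

Lemma local_isometry_smooth X Y (f : X -> Y) :
  local_isometry f -> smooth_map_on setT f.
Proof.
move=> lf; split=> [x _|i j].
  by have [U [_ Ux _ [[cf _] _] _]] := lf x; exact: cf.
apply: smooth_on_local => y [iy _ fy].
have [U [_ Ux _ [[_ sf] _] _]] := lf (chart_inv (atlas i) y).
exists (in_charts (atlas i) (atlas j) f), (in_charts_dom (atlas i) (atlas j) U f).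
by split; [exact: sf| |apply: filterE].
Qed.

(** Row [i] of the product is the derivative of [g \o f] along the [i]-th basis vector; with row
    vectors the Jacobian of the inner map stands on the left. *)
Lemma jacobian_left_inverse (f g : 'rV[R]_n -> 'rV[R]_n) (y : 'rV[R]_n) :
  differentiable f y -> differentiable g (f y) ->
  (\near y, g (f y) = y) -> jacobian f y *m jacobian g (f y) = 1%:M.
Proof.
move=> df dg gf; apply/row_matrixP => i; rewrite !rowE mulmxA mulmx1.
set v := delta_mx _ _.
rewrite /jacobian !mul_rV_lin1 /=.
have E : 'd (g \o f) y = 'd g (f y) \o 'd f y :> ('rV[R]_n -> 'rV[R]_n).
  exact: diff_comp.
rewrite -[LHS]/(('d g (f y) \o 'd f y) v) -E -deriveE; last first.
  exact: differentiable_comp.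
rewrite (near_eq_derive (g := id)) //.
by rewrite derive_id.
Qed.

(** In lifted charts [p] has the local expression of [q \o p], and a local inverse [s] of [q \o p]
    gives the local inverse [s \o q] of [p]. *)
Lemma local_isometry_covering_manifold (Mhat M : riemannian_manifold R n)
    (X : topologicalType) (p : Mhat -> X) (q : X -> M) (cq : covering_map q)
    (X0 : [set: X] !=set0) (X1 : connected [set: X]) (X2 : @second_countable X) :
  continuous p -> (forall U, open U -> open (p @` U)) ->
  local_isometry (q \o p) ->
  local_isometry (p : Mhat -> covering_manifold cq X0 X1 X2).
Proof.
move=> pc po lqp x; have [U [oU Ux oqU [[_ sqp] mqp] [s [[cs ss] sK]]]] := lqp x.
have qpU z : (p @` U) z -> ((q \o p) @` U) (q z).
  by move=> [w Uw <-]; exists w.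
exists U; split=> //; [exact: po|split|].
- split=> [z _|a [i t]]; first exact: pc.
  apply: smooth_on_sub (sqp a i) => y [ay Uy [_ iy]]; by split.
- by move=> a [i t] y [ay Uy [_ iy]]; apply: (mqp a i y); split.
- exists (s \o q); split; last by move=> z Uz; exact: sK.
  split=> [z Uz|[i t] a].
    apply: continuous_comp; first exact: covering_continuous.
    exact/cs/qpU.
  have -> : in_charts (atlas (r := covering_manifold cq X0 X1 X2) (i, t))
      (atlas a) (s \o q) = in_charts (atlas i) (atlas a) s.
    by apply/funext => y; rewrite /in_charts /= sheet_secK.
  apply: smooth_on_sub (ss i a) => y [[iy _] /qpU Uy ay].
  by split=> //; [move: Uy|move: ay]; rewrite /= sheet_secK.
Qed.

(* Read through [q], the map [psi] is locally a smooth section of [q']. *)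
Lemma covering_manifold_isometry (M N : riemannian_manifold R n)
    (X : topologicalType) (q : X -> M) (cq : covering_map q)
    (X0 : [set: X] !=set0) (X1 : connected [set: X]) (X2 : @second_countable X)
    (q' : N -> M) (psi : X -> N) (psi' : N -> X) :
  local_isometry q' -> continuous psi -> continuous psi' ->
  cancel psi psi' -> cancel psi' psi -> q' \o psi = q ->
  riemannian_isometry (psi : covering_manifold cq X0 X1 X2 -> N).
Proof.
move=> lq' cpsi cpsi' psiK psiK' qpsi.
set C := covering_manifold cq X0 X1 X2.
have q'psi z : q' (psi z) = q z by rewrite -qpsi.
have cont_psi i (s : sheet q) y (U : set N) : chart_img (atlas i) y ->
    sheet_base s (chart_inv (atlas i) y) -> open U ->
    U (psi (sheet_sec s (chart_inv (atlas i) y))) ->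
    \near y, U (psi (sheet_sec s (chart_inv (atlas i) y))).
  move=> iy sy oU Uy.
  have cont : {for y, continuous (psi \o (sheet_sec s \o chart_inv (atlas i)))}.
    apply: continuous_comp; last exact: cpsi.
    apply: continuous_comp; first exact: chart_inv_continuous.
    exact: sheet_sec_continuous.
  by apply: cont; exact: open_nbhsW oU Uy.
have smooth_psi : smooth_map_on setT (psi : C -> N).
  split=> [x _|[i s] j]; first exact: cpsi.
  apply: smooth_on_local => y [[iy sy] _ jy].
  have [U [oU Ux _ _ [t [[_ st] tK]]]] := lq' (psi (sheet_sec s (chart_inv (atlas i) y))).
  exists (in_charts (atlas i) (atlas j) t).
  exists (in_charts_dom (atlas i) (atlas j) (q' @` U) t).
  have tE w : U (psi (sheet_sec s w)) -> t w = psi (sheet_sec s w).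
    by move=> /tK <-; rewrite q'psi sheet_secK.
  split; first exact: st.
    split=> //.
      exists (psi (sheet_sec s (chart_inv (atlas i) y))) => //.
      by rewrite q'psi sheet_secK.
    by rewrite tE.
  have nU := cont_psi i s y U iy sy oU Ux.
  apply: filterS nU => z Uz.
  by rewrite /in_charts /= tE.
split=> //.
- move=> [i s] j y yd; have [[iy sy] _ jy] := yd.
  have [U [oU Ux _ [[_ sq'] mq'] _]] := lq' (psi (sheet_sec s (chart_inv (atlas i) y))).
  set f := in_charts _ _ _ in yd *; set J := jacobian f y => /=.
  (* The expression [k] of [q'] inverts [f] near [y]. With [K] its Jacobian, [q'] gives
     [h = K g K^T] for the two metric matrices, and [J K = 1] turns [J h J^T] into [g]. *)
  pose k := in_charts (atlas j) (atlas i) q'.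
  have fyd : in_charts_dom (atlas j) (atlas i) U q' (f y).
    split; first exact: chart_fun_img.
      by rewrite /f /in_charts /= chart_funK.
    by rewrite /f /in_charts /= chart_funK // q'psi sheet_secK; exact: chart_inv_dom.
  have kf : \near y, k (f y) = y.
    have near_j := cont_psi i s y _ iy sy (chart_dom_open (atlas j)) jy.
    have near_i : nbhs y (chart_img (atlas i)).
      by apply: open_nbhsW iy; exact: chart_img_open.
    apply: filterS2 near_i near_j => z iz jz.
    by rewrite /k /f /in_charts /= chart_funK // q'psi sheet_secK chart_invK.
  have df : differentiable f y.
    by apply: smooth_on_differentiable (smooth_psi.2 (i, s) j) yd.
  have dk : differentiable k (f y).
    by apply: smooth_on_differentiable (sq' j i) fyd.
  have JK := jacobian_left_inverse df dk kf.
  have kfy : k (f y) = y by exact: nbhs_singleton kf.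
  have /= -> := mq' j i (f y) fyd.
  rewrite -/k kfy !mulmxA -/J JK mul1mx -mulmxA -trmx_mul JK.
  by rewrite trmx1 mulmx1.
- exists psi'; split=> //; split=> [x _|j [i s]]; first exact: cpsi'.
  have -> : in_charts (atlas j) (atlas (r := C) (i, s)) psi' =
      in_charts (atlas j) (atlas i) q'.
    by apply/funext => y; rewrite /in_charts /= -q'psi psiK'.
  apply: smooth_on_sub ((local_isometry_smooth lq').2 j i) => y [jy _ [_ iy]].
  by split=> //; move: iy; rewrite /preimage /= -q'psi psiK'.
Qed.

End LocalIsometries.

Section Decompositions.
Context {R : realType} {n : nat} (M Mhat N : riemannian_manifold R n).
Context (F : set (set M)) (q : Mhat -> M) (p : Mhat -> N) (pi : N -> M).
Hypotheses (partF : is_partition F) (rp : regular_covering p)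
  (rpi : regular_covering pi) (pip : pi \o p = q).

Let pc : continuous p := covering_continuous rp.1.
Let conMhat : connected [set: Mhat] := @manifold_connected _ _ Mhat.

Lemma leaf_deck_lift phi : regular_covering q -> leaf_deck pi F phi ->
  exists2 g, covering_transformation q g & phi \o p = p \o g.
Proof.
move=> [_ rq] [dphi _]; have [x _] := @manifold_nonempty _ _ Mhat.
have [x' px'] := covering_surjective rp.1 (phi (p x)).
have [|g dg gx] := rq x x'.
  by rewrite -pip /= px' (deck_fiber _ dphi).
exists g => //; apply: (deck_intertwine pc rpi.1 conMhat (x := x)) => //.
  by rewrite pip.
by rewrite gx px'.
Qed.

Lemma leaf_deck_factor g : condC2 (lifted_system pi F) pi ->
  leaf_deck q F g -> p \o g = p.
Proof.
move=> C2 [dg gl]; have [x _] := @manifold_nonempty _ _ Mhat.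
(* Regularity of [pi] provides the transformation induced by [g] from one base point;
   [deck_intertwine] makes it compatible everywhere. *)
have [|phi dphi phix] := rpi.2 (p x) (p (g x)).
  by rewrite -[LHS]/((pi \o p) x) -[RHS]/((pi \o p) (g x)) pip (deck_fiber _ dg).
have dg' : covering_transformation (pi \o p) g by rewrite pip.
have phip := deck_intertwine pc rpi.1 conMhat dphi dg' phix.
rewrite -phip (C2 phi) //; apply/leaf_deckP => //; split=> // y.
have [z <-] := covering_surjective rp.1 y.
rewrite -[phi (p z)]/((phi \o p) z) phip.
exact: (leaf_map partF pc pip (gl z)).
Qed.

Lemma condC1_leaf_deck g : condC1 (lifted_system q F) p ->
  covering_transformation p g -> leaf_deck q F g.
Proof.
move=> C1 dg; apply/leaf_deckP => //; last exact: C1.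
by rewrite -pip; exact: deck_factor.
Qed.

Lemma decomposition_fibers x x' : condC1 (lifted_system q F) p ->
  condC2 (lifted_system pi F) pi ->
  p x = p x' <-> exists2 g, leaf_deck q F g & g x = x'.
Proof.
move=> C1 C2; split=> [/(rp.2) [g dg gx]|[g gd <-]].
  by exists g => //; exact: condC1_leaf_deck.
by rewrite -[RHS]/((p \o g) x) leaf_deck_factor.
Qed.

End Decompositions.

Theorem proposition3p7 (R : realType) (n : nat)
    (M Mhat : riemannian_manifold R n)
    (F : set (set M)) (Fhat : set (set Mhat)) (pihat : Mhat -> M)
    (M_complete : complete_manifold M)
    (F_transnormal : embedded_transnormal_system F)
    (F_codim1 : has_codimension F 1)
    (pihat_covering : regular_system_covering Fhat F pihat) :
  exists (Mtil : riemannian_manifold R n) (Ftil : set (set Mtil))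
         (p : Mhat -> Mtil) (pitil : Mtil -> M),
    [/\ complete_manifold Mtil /\ embedded_transnormal_system Ftil,
        regular_decomposition Fhat Ftil F pihat p pitil,
        condC1 Fhat p, condC2 Ftil pitil &
        forall (Mtil' : riemannian_manifold R n) (Ftil' : set (set Mtil'))
               (p' : Mhat -> Mtil') (pitil' : Mtil' -> M),
          regular_decomposition Fhat Ftil' F pihat p' pitil' ->
          condC1 Fhat p' -> condC2 Ftil' pitil' ->
          exists psi : Mtil -> Mtil',
            [/\ riemannian_isometry psi, psi \o p = p', pitil' \o psi = pitil &
                Ftil' = [set psi @` A | A in Ftil]]].
Proof.
have [partF _ _] := F_transnormal.
have [rq lq FhatE] := pihat_covering; rewrite {}FhatE {Fhat pihat_covering}.
set E := fun x x' => exists2 g, leaf_deck pihat F g & g x = x'.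
have [X [p [psurj pE pquot]]] : exists (X : topologicalType) (p : Mhat -> X),
    [/\ forall y, exists x, p x = y, forall x x', p x = p x' <-> E x x' &
        forall U : set X, open U <-> open (p @^-1` U)].
  apply: topological_quotient.
  - by move=> x; exists idfun => //; exact: leaf_deck_id.
  - move=> x x' [g gd <-]; have [h [hd gK _]] := leaf_deck_inverse partF gd.
    by exists h.
  - move=> x _ _ [g gd <-] [g' gd' <-].
    by exists (g' \o g) => //; exact: leaf_deck_comp.
have [pi pip] := quotient_projection psurj pE.
have rp := quotient_map_regular rq partF psurj pE pquot pip.
have rpi := quotient_projection_regular rq partF psurj pE pquot pip.
pose Mtil := covering_manifold rpi.1 (quotient_nonempty p)
  (quotient_connected psurj pquot)
  (quotient_second_countable partF psurj pE pquot).
have transFtil : embedded_transnormal_system (M := Mtil) (lifted_system pi F).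
  exact: transnormal_covering.
have partFtil : is_partition (M := Mtil) (lifted_system pi F) by case: transFtil.
have pc := quotient_map_continuous pquot.
have leaf_p := quotient_leaf_preimage rq partF psurj pE pquot pip F_transnormal.
exists Mtil, (lifted_system pi F), p, pi; split.
- by split=> //; exact: complete_covering.
- split=> //; split=> //.
  + apply: local_isometry_covering_manifold => //; last by rewrite pip.
    exact: (quotient_map_open partF pE pquot).
  + rewrite (lifted_systemE partF) (lifted_systemE (Y := Mtil) partFtil).
    suff -> : leaf pihat F = leaf (Y := Mtil) p (lifted_system pi F) by [].
    apply/funext => x; rewrite [RHS]/leaf.
    (* The preimage under [p] of the leaf through [p x] is the leaf of [x], hence already connected,
       so taking its component changes nothing. *)
    rewrite (@foilE _ _ Mtil _ (leaf pi F (p x))) //.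
    * rewrite leaf_p connected_component_id //; last exact: connected_leaf.
      exact: leaf_refl.
    * by rewrite (lifted_systemE partF); exists (p x).
    * exact: leaf_refl.
  + exact: covering_manifold_local_isometry.
- move=> g /(quotient_deckP pE pip) gd.
  by apply/leaf_deckP => //; exact: gd.1.
- move=> phi dphi phiF.
  have phil : leaf_deck pi F phi by apply/leaf_deckP.
  have [g dg phip] := leaf_deck_lift (N := Mtil) rp rpi pip rq phil.
  have gd : leaf_deck pihat F g.
    split=> // x; rewrite -leaf_p /preimage /= -[p (g x)]/((p \o g) x) -phip.
    exact: phil.2.
  apply/funext => y; have [x <-] := psurj y.
  rewrite -[LHS]/((phi \o p) x) phip /=; apply/esym/pE.
  by exists g.
- move=> Mtil' Ftil' p' pi' [[rp' lp' FhatE] [rpi' lpi' Ftil'E] pip'] C1 C2.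
  rewrite Ftil'E in C2 *.
  (* Equal fibres make [psi] and [psi'], defined through chosen representatives, independent of the
     choices and inverse to each other. *)
  have p'E x x' : p' x = p' x' <-> p x = p x'.
    by rewrite pE; exact: (decomposition_fibers partF rp' rpi' (esym pip') x x' C1 C2).
  have [r rK] := choice psurj.
  have [r' rK'] := choice (covering_surjective rp'.1).
  have p'r x : p' (r (p x)) = p' x by apply/p'E; rewrite rK.
  have pr' x : p (r' (p' x)) = p x by apply/p'E; rewrite rK'.
  pose psi : Mtil -> Mtil' := p' \o r; pose psi' : Mtil' -> Mtil := p \o r'.
  have psip : psi \o p = p' by apply/funext => x; exact: p'r.
  have psip' : psi' \o p' = p by apply/funext => x; exact: pr'.
  have psic : continuous psi.
    apply: (quotient_map_descent pquot); rewrite psip.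
    exact: covering_continuous rp'.1.
  have psic' : continuous psi'.
    move=> y; have [x <-] := covering_surjective rp'.1 y.
    by apply: (covering_continuous_descent rp'.1); rewrite psip'; exact: pc.
  have psiK : cancel psi psi'.
    move=> y; have [x <-] := psurj y.
    by rewrite -[psi (p x)]/((psi \o p) x) psip; exact: pr'.
  have psiK' : cancel psi' psi.
    move=> y; have [x <-] := covering_surjective rp'.1 y.
    by rewrite -[psi' (p' x)]/((psi' \o p') x) psip'; exact: p'r.
  have pipsi : pi' \o psi = pi.
    apply/funext => y; have [x <-] := psurj y.
    by rewrite -[LHS]/(pi' ((psi \o p) x)) psip -[LHS]/((pi' \o p') x) -pip' -pip.
  exists psi; split=> //; first exact: covering_manifold_isometry psiK psiK' _.
  rewrite !(lifted_systemE partF); apply/seteqP; split=> [_ [y _ <-]|_ [_ [y _ <-] <-]].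
    exists (leaf pi F (psi' y)); first by exists (psi' y).
    by rewrite (leaf_homeo _ partF psic psic' psiK psiK' pipsi) psiK'.
  by exists (psi y) => //; rewrite (leaf_homeo _ partF psic psic' psiK psiK' pipsi).
Qed.
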